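(* Let $G=L\ltimes U$ be a (block upper triangular) parabolic subgroup of $\mathrm{GL}(n,\mathbb{F}_q)$. Then the system of characters $\{\chi_\alpha:\ \alpha=(\theta,D)\in\mathcal{A}\}$ together with the system of subsets $\{K_\beta:\ \beta=(h,D)\in\mathcal{B}\}$ is a supercharacter theory of the group $G$.
   Context: **Supercharacter theory.** A supercharacter theory of a finite group $G$ is a pair $(\mathfrak{S},\mathcal{K})$, where $\mathfrak{S}=\{\chi_1,\dots,\chi_m\}$ is a system of pairwise orthogonal complex characters of $G$ and $\mathcal{K}=\{K_1,\dots,K_m\}$ is a partition of $G$ (the same number $m$ of characters and of classes), such that each $\chi_i$ is constant on each $K_j$ and $\{1\}\in\mathcal{K}$. **Parabolic subgroup.** Decompose $[1,n]=I_1\cup\dots\cup I_\ell$ into consecutive segments, $n_k=|I_k|$. $G$ is the group of invertible block upper triangular matrices over $\mathbb{F}_q$ for this decomposition, $L=\mathrm{GL}(n_1,\mathbb{F}_q)\times\dots\times\mathrm{GL}(n_\ell,\mathbb{F}_q)$ is the block diagonal subgroup with elements $h=(h_1,\dots,h_\ell)$, $J$ is the algebra of strictly block upper triangular matrices, and $U=1+J$, so $G=L\ltimes U$. The group $G$ acts on $J$ by left and right matrix multiplication, and on $J^*$ by $(g\lambda)(x)=\lambda(xg)$, $(\lambda g)(x)=\lambda(gx)$; for $h\in L$, $\mathrm{Ad}^*_h(\lambda)=h\lambda h^{-1}$. **Rook placements.** A $J$-root is a pair $\gamma=(i,j)$ with the matrix unit $E_{ij}\in J$; $\Delta_J$ is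 the set of $J$-roots, $\{E_\gamma\}$ is a basis of $J$ and $\{E^*_\gamma\}$ the dual basis of $J^*$. A rook placement is a subset $D\subset\Delta_J$ having at most one root in each row and at most one root in each column. Put $x_D=\sum_{\gamma\in D}E_\gamma$, $\lambda_D=\sum_{\gamma\in D}E^*_\gamma$, and $d_{km}=|D\cap(I_k\times I_m)|$ for $1\le k<m\le\ell$. Two rook placements $D,D'$ are equivalent if $d_{km}=d'_{km}$ for all $k<m$; ''rook placement classes'' are the classes of this equivalence. **Characters.** For a rook placement $D$ let $H(D)=H_{G\lambda_DG}=\{h\in L:\mathrm{Ad}^*_h\mu=\mu\ \text{for all }\mu\in G\lambda_DG\}$. Explicitly, $H(D)=\bigcap_{\gamma\in D}H(\gamma)$ where, for $\gamma=(i,j)$ with $i\in I_k$, $j\in I_m$, $H(\gamma)$ consists of all $h\in L$ such that $(h_k,\dots,h_m)$ is a scalar matrix (all of $h_k,\dots,h_m$ are scalar with the same scalar), with $h_t$ arbitrary for $t\notin[k,m]$. Let $\mathcal{A}$ be the set of pairs $(\theta,D)$ where $D$ runs through representatives of the rook placement classes in $\Delta_J$ and $\theta$ runs through all irreducible complex characters of $H(D)$. Fix a nontrivial additive character $t\mapsto\varepsilon^t$ of $\mathbb{F}_q$ with values in $\mathbb{C}^*$. For $\alpha=(\theta,D)$ and $\lambda=\lambda_D$, put $J_{\lambda,\mathrm{right}}=\{y\in J:\lambda(yx)=0\ \text{for all }x\in J\}$ and $G_{0,\lambda}=H(D)\ltimes(1+J_{\lambda,\mathrm{right}})$; for $p\in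 L$ the formula $\xi_{\theta,p\lambda}(h(1+x))=\theta(h)\varepsilon^{(p\lambda)(x)}$ ($h\in H(D)$, $x\in J_{\lambda,\mathrm{right}}$) defines a character of $G_{0,\lambda}$, and $\chi_\alpha$ is the character of $G$ induced from $\sum_{p\in L}\xi_{\theta,p\lambda}$. **Classes.** For $h=(h_1,\dots,h_\ell)\in L$ let $J_h\subset J$ be the orthogonal complement of the largest $G\times G$-invariant subspace of $J^*$ on which $\mathrm{Ad}^*_h$ acts as the identity. Explicitly, take the coarsest decomposition $[1,\ell]=\bigcup[k_i,m_i]$ into consecutive segments such that for each segment $[k,m]$ either $k=m$, or $k<m$ and $(h_k,\dots,h_m)$ is a scalar matrix; then $J_h$ is the algebra of strictly block upper triangular matrices for the decomposition of $[1,n]$ with components $I_{k_i}\cup\dots\cup I_{m_i}$. Let $\pi_h:J\to J/J_h$ be the natural projection and $\Delta_h=\{\gamma\in\Delta_J:E_\gamma\notin J_h\}$. Let $\mathcal{B}$ be the set of pairs $(h,D)$, where $h$ runs through representatives of the conjugacy classes of $L$ and $D$ runs through representatives of the rook placement classes in $\Delta_h$ (rook placements contained in $\Delta_h$, up to the equivalence under which $D,D'$ are equivalent if $d_{km}=d'_{km}$ for all $1\le k<m\le\ell$, where $d_{km}=|D\cap(I_k\times I_m)|$ and $d'_{km}=|D'\cap(I_k\times I_m)|$). For $\beta=(h,D)$ let $\omega$ be the $G\times G$ orbit of $\pi_h(x_D)$ in $J/J_h$ and $K_\beta=\mathrm{Cl}_L(h)\cdot(1+\pi_h^{-1}(\omega))$,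 with $\mathrm{Cl}_L(h)$ the conjugacy class of $h$ in $L$. *)

(* Defs.v *)
From HB Require Import structures.
From mathcomp Require Import all_boot all_order all_algebra all_fingroup.
From mathcomp Require Import all_solvable all_field all_character.

Set Implicit Arguments.
Unset Strict Implicit.
Unset Printing Implicit Defensive.

Import Order.TTheory GRing.Theory Num.Theory GroupScope.
Local Open Scope ring_scope.

(* The field of complex numbers is represented by algC, as in all of the      *)
(* MathComp character library.  Both systems are indexed families, given as   *)
(* sequences: pairwise_orthogonal forces the characters to be nonzero and     *)
(* distinct for distinct indices, and uniq does the same for the classes.     *)
Definition supercharacter_theory (gT : finGroupType) (G : {group gT})
    (S : seq 'CF(G)) (K : seq {set gT}) : Prop :=
  [/\ size S = size K,
      {subset S <= character} /\ pairwise_orthogonal S,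
      uniq K /\ partition [set X in K] G,
      forall chi X, chi \in S -> X \in K -> {in X &, forall x y, chi x = chi y}
    & [set 1%g] \in K].

Record additive_character (F : finFieldType) := AdditiveCharacter {
  addchar_val :> F -> algC;
  addcharD : forall s t, addchar_val (s + t) = addchar_val s * addchar_val t;
  addchar_neq0 : forall t, addchar_val t != 0
}.

(* GL(n+1, F) with its finite group structure fixed once and for all: on      *)
(* elements of type {'GL_n.+1[F]} the products are elaborated through another *)
(* inheritance path, which is very expensive to convert.                      *)
Definition GLn (F : finFieldType) (n : nat) : finGroupType := {'GL_n.+1[F]}.

Section Parabolic.

(* A decomposition of the n.+1 indices into l consecutive nonempty segments   *)
(* is a nondecreasing surjection b, the segment I_k being the fibre of k.     *)
(* These two properties of b are only assumed in the theorem.                 *)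
Variables (F : finFieldType) (n l : nat) (b : 'I_n.+1 -> 'I_l).

Local Notation M := 'M[F]_n.+1.
Local Notation GL := (GLn F n).
Local Notation root := ('I_n.+1 * 'I_n.+1)%type.

Definition mx (g : GL) : M := GLval g.

Lemma mx1 : mx 1%g = 1. Proof. by []. Qed.

Lemma mxM (g h : GL) : mx (g * h)%g = mx g *m mx h. Proof. by []. Qed.

Lemma mx_inj : injective mx. Proof. exact: val_inj. Qed.

Definition parabolic : {set GL} :=
  [set g : GL | [forall i, forall j, (b j < b i)%N ==> (mx g i j == 0)]].

Definition levi : {set GL} :=
  [set g : GL | [forall i, forall j, (b i != b j) ==> (mx g i j == 0)]].

Lemma parabolicP (g : GL) :
  reflect (forall i j, (b j < b i)%N -> mx g i j = 0) (g \in parabolic).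
Proof.
rewrite inE; apply: (iffP forallP) => [gP i j bij | gP i].
  by have /forallP/(_ j)/implyP/(_ bij)/eqP := gP i.
by apply/forallP=> j; apply/implyP=> bij; rewrite gP.
Qed.

Lemma leviP (g : GL) :
  reflect (forall i j, b i != b j -> mx g i j = 0) (g \in levi).
Proof.
rewrite inE; apply: (iffP forallP) => [gP i j bij | gP i].
  by have /forallP/(_ j)/implyP/(_ bij)/eqP := gP i.
by apply/forallP=> j; apply/implyP=> bij; rewrite gP.
Qed.

Fact parabolic_group_set : group_set parabolic.
Proof.
apply/group_setP; split=> [|g h /parabolicP gP /parabolicP hP].
  apply/parabolicP=> i j bij; rewrite mx1 mxE.
  by case: eqVneq bij => // ->; rewrite ltnn.
apply/parabolicP=> i j bij; rewrite mxM mxE big1 // => k _.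
have [bki|bik] := ltnP (b k) (b i); first by rewrite gP ?mul0r.
by rewrite hP ?mulr0 //; apply: leq_trans bik.
Qed.
Canonical parabolic_group := Group parabolic_group_set.

Fact levi_group_set : group_set levi.
Proof.
apply/group_setP; split=> [|g h /leviP gP /leviP hP].
  by apply/leviP=> i j bij; rewrite mx1 mxE; case: (i =P j) bij => [->|//]; rewrite eqxx.
apply/leviP=> i j bij; rewrite mxM mxE big1 // => k _.
have [bik|bik] := eqVneq (b i) (b k); last by rewrite gP ?mul0r.
by rewrite hP ?mulr0 // -bik.
Qed.
Canonical levi_group := Group levi_group_set.

Lemma levi_sub : levi \subset parabolic.
Proof.
apply/subsetP=> g /leviP gP; apply/parabolicP=> i j bij; apply: gP.
by apply: contraTneq bij => ->; rewrite ltnn.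
Qed.

Definition Jalg : {vspace M} :=
  (\bigcap_(ij : root | (b ij.2 <= b ij.1)%N)
     lker (linfun (fun x : M => x ij.1 ij.2 : F^o)))%VS.

Fact entry_is_linear (ij : root) : linear (fun x : M => x ij.1 ij.2 : F^o).
Proof. by move=> a x y; rewrite !mxE. Qed.

Lemma JalgP (x : M) :
  reflect (forall i j, (b j <= b i)%N -> x i j = 0) (x \in Jalg).
Proof.
have entryE ij : linfun (fun x : M => x ij.1 ij.2 : F^o) x = x ij.1 ij.2.
  pose f := HB.pack_for {linear M -> F^o} (fun x : M => x ij.1 ij.2 : F^o)
    (GRing.isLinear.Build _ _ _ _ _ (entry_is_linear ij)).
  exact: (lfunE f).
rewrite memvE; apply: (iffP subv_bigcapP) => [xP i j bij | xP [i j] bij].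
  by have := xP (i, j) bij; rewrite -memvE memv_ker entryE => /eqP.
by rewrite -memvE memv_ker entryE; apply/eqP/xP.
Qed.

Lemma Jalg_mulGr (x : M) (g : GL) :
  x \in Jalg -> g \in parabolic -> x *m mx g \in Jalg.
Proof.
move=> /JalgP xP /parabolicP gP; apply/JalgP=> i j bij.
rewrite mxE big1 // => k _.
have [bki|bik] := leqP (b k) (b i); first by rewrite xP ?mul0r.
by rewrite gP ?mulr0 //; apply: leq_ltn_trans bij bik.
Qed.

Lemma Jalg_mulGl (x : M) (g : GL) :
  x \in Jalg -> g \in parabolic -> mx g *m x \in Jalg.
Proof.
move=> /JalgP xP /parabolicP gP; apply/JalgP=> i j bij.
rewrite mxE big1 // => k _.
have [bki|bik] := ltnP (b k) (b i); first by rewrite gP ?mul0r.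
by rewrite xP ?mulr0 //; apply: leq_trans bij bik.
Qed.

Lemma Jalg_mul (x y : M) : x \in Jalg -> y \in Jalg -> x *m y \in Jalg.
Proof.
move=> /JalgP xP /JalgP yP; apply/JalgP=> i j bij.
rewrite mxE big1 // => k _.
have [bki|bik] := leqP (b k) (b i); first by rewrite xP ?mul0r.
by rewrite yP ?mulr0 //; apply: leq_trans bij (ltnW bik).
Qed.

Local Notation Jdual := 'Hom(subvs_of Jalg, F^o).

Definition ev (mu : Jdual) (x : M) : F := mu (vsproj Jalg x).

Lemma evD mu (x y : M) : ev mu (x + y) = ev mu x + ev mu y.
Proof. by rewrite /ev !linearD. Qed.

Lemma dualP (mu nu : Jdual) :
  (forall x, x \in Jalg -> ev mu x = ev nu x) -> mu = nu.
Proof.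
move=> eq_mu; apply/lfunP=> x.
by have := eq_mu (vsval x) (subvsP x); rewrite /ev vsvalK.
Qed.

Definition lact (g : GL) (mu : Jdual) : Jdual :=
  linfun (fun x : subvs_of Jalg => ev mu (vsval x *m mx g) : F^o).

Definition ract (mu : Jdual) (g : GL) : Jdual :=
  linfun (fun x : subvs_of Jalg => ev mu (mx g *m vsval x) : F^o).

Definition Ad (h : GL) (mu : Jdual) : Jdual := lact h (ract mu h^-1%g).

Lemma lactE g mu (x : M) :
  x \in Jalg -> ev (lact g mu) x = ev mu (x *m mx g).
Proof.
move=> Jx; rewrite {1}/ev /lact.
have lin : linear (fun x : subvs_of Jalg => ev mu (vsval x *m mx g) : F^o).
  by move=> a u v; rewrite linearP /= mulmxDl -scalemxAl /ev !linearP.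
pose f := HB.pack_for {linear subvs_of Jalg -> F^o}
  (fun x : subvs_of Jalg => ev mu (vsval x *m mx g) : F^o)
  (GRing.isLinear.Build _ _ _ _ _ lin).
by rewrite (lfunE f) /= vsprojK.
Qed.

Lemma ractE g mu (x : M) :
  x \in Jalg -> ev (ract mu g) x = ev mu (mx g *m x).
Proof.
move=> Jx; rewrite {1}/ev /ract.
have lin : linear (fun x : subvs_of Jalg => ev mu (mx g *m vsval x) : F^o).
  by move=> a u v; rewrite [vsval _]linearP /= mulmxDr -scalemxAr /ev !linearP.
pose f := HB.pack_for {linear subvs_of Jalg -> F^o}
  (fun x : subvs_of Jalg => ev mu (mx g *m vsval x) : F^o)
  (GRing.isLinear.Build _ _ _ _ _ lin).
by rewrite (lfunE f) /= vsprojK.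
Qed.

Lemma lactM g h mu : g \in parabolic -> lact g (lact h mu) = lact (g * h)%g mu.
Proof.
move=> Gg; apply: dualP=> x Jx.
by rewrite !lactE ?Jalg_mulGr // mxM mulmxA.
Qed.

Lemma ractM g h mu : h \in parabolic -> ract (ract mu g) h = ract mu (g * h)%g.
Proof.
move=> Gg; apply: dualP=> x Jx.
by rewrite !ractE ?Jalg_mulGl // mxM mulmxA.
Qed.

Lemma lractA g h mu : g \in parabolic -> h \in parabolic ->
  lact g (ract mu h) = ract (lact g mu) h.
Proof.
move=> Gg Gh; apply: dualP=> x Jx.
by rewrite lactE // !ractE ?Jalg_mulGr // lactE ?Jalg_mulGl // mulmxA.
Qed.

Lemma lact1 mu : lact 1%g mu = mu.
Proof. by apply: dualP=> x Jx; rewrite lactE // mx1 mulmx1. Qed.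

Lemma ract1 mu : ract mu 1%g = mu.
Proof. by apply: dualP=> x Jx; rewrite ractE // mx1 mul1mx. Qed.

Lemma lact_linear g : linear (lact g).
Proof.
move=> a mu nu; apply: dualP=> x Jx.
by rewrite lactE // /ev !add_lfunE !scale_lfunE -!/(ev _ _) !lactE.
Qed.

Lemma ract_linear g : linear (ract^~ g).
Proof.
move=> a mu nu; apply: dualP=> x Jx.
by rewrite ractE // /ev !add_lfunE !scale_lfunE -!/(ev _ _) !ractE.
Qed.

Lemma AdE h mu (x : M) : h \in parabolic -> x \in Jalg ->
  ev (Ad h mu) x = ev mu (mx h^-1%g *m x *m mx h).
Proof.
by move=> Gh Jx; rewrite lactE // ractE ?Jalg_mulGr // mulmxA.
Qed.

Lemma AdM g h mu : g \in parabolic -> h \in parabolic ->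
  Ad g (Ad h mu) = Ad (g * h)%g mu.
Proof.
move=> Gg Gh; have Gg' := groupVr Gg; have Gh' := groupVr Gh.
by rewrite /Ad -(lractA _ Gh Gg') (lactM _ _ Gg) (ractM _ _ Gg') -invMg.
Qed.

Definition stab (lam : Jdual) : {set GL} :=
  [set h in levi | [forall g1 in parabolic, forall g2 in parabolic,
     Ad h (lact g1 (ract lam g2)) == lact g1 (ract lam g2)]].

Lemma stabP lam (h : GL) :
  reflect (h \in levi /\ forall g1 g2, g1 \in parabolic -> g2 \in parabolic ->
             Ad h (lact g1 (ract lam g2)) = lact g1 (ract lam g2))
          (h \in stab lam).
Proof.
rewrite [h \in stab lam]inE; apply: (iffP andP) => -[Lh hP]; split=> //.
  move=> g1 g2 Gg1 Gg2.
  by have /forall_inP/(_ g1 Gg1)/forall_inP/(_ g2 Gg2)/eqP := hP.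
by apply/forall_inP=> g1 Gg1; apply/forall_inP=> g2 Gg2; rewrite hP.
Qed.

Fact stab_group_set lam : group_set (stab lam).
Proof.
apply/group_setP; split=> [|g h /stabP[Lg gP] /stabP[Lh hP]].
  apply/stabP; split=> [|g1 g2 _ _]; first exact: group1.
  by rewrite /Ad invg1 lact1 ract1.
apply/stabP; split=> [|g1 g2 Gg1 Gg2]; first exact: groupM.
by rewrite -AdM ?(subsetP levi_sub) // hP ?gP.
Qed.
Canonical stab_group lam := Group (stab_group_set lam).

Definition Jright (lam : Jdual) : {set M} :=
  [set y in Jalg | [forall x in Jalg, ev lam (y *m x) == 0]].

Lemma JrightP lam (y : M) :
  reflect (y \in Jalg /\ forall x, x \in Jalg -> ev lam (y *m x) = 0)
          (y \in Jright lam).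
Proof.
rewrite [y \in Jright lam]inE; apply: (iffP andP) => -[Jy yP]; split=> //.
  by move=> x Jx; have /forall_inP/(_ x Jx)/eqP := yP.
by apply/forall_inP=> x Jx; rewrite yP.
Qed.

(* The subset 1 + X of GL, for X a set of matrices.                           *)
Definition one_plus (X : {set M}) : {set GL} := [set u : GL | mx u - 1 \in X].

(* No element of 1 + X is lost above when X is contained in J.                *)
Lemma one_plus_unit (x : M) : {homo b : i j / (i <= j)%N} ->
  x \in Jalg -> 1 + x \is a GRing.unit.
Proof.
move=> b_mono /JalgP xP; rewrite -[_ \is a _]/(_ \in unitmx) -unitmx_tr unitmxE.
rewrite det_trig.
  rewrite big1 ?unitr1 // => i _.
  by rewrite !mxE eqxx xP ?addr0.
apply/is_trig_mxP=> i j ij; rewrite !mxE xP ?addr0; last exact/b_mono/ltnW.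
by case: eqVneq ij => // ->; rewrite ltnn.
Qed.

Definition U0 (lam : Jdual) : {set GL} := one_plus (Jright lam).

Lemma U0P lam (u : GL) : reflect (mx u - 1 \in Jright lam) (u \in U0 lam).
Proof. by rewrite [u \in _]inE; apply: idP. Qed.

Lemma one_plus_mul (u v : GL) : mx (u * v)%g - 1 =
  (mx u - 1) + (mx v - 1) + (mx u - 1) *m (mx v - 1).
Proof.
rewrite mxM mulmxBl mulmxBr mulmx1 mul1mx.
set w := mx v - 1; set z := mx u *m _.
by rewrite -[X in _ = X]addrA [w + _]addrC subrK addrC addrA subrK.
Qed.

Fact U0_group_set lam : group_set (U0 lam).
Proof.
apply/group_setP; split=> [|u v /U0P/JrightP[Ju uP] /U0P/JrightP[Jv vP]].
  apply/U0P/JrightP; rewrite mx1 subrr mem0v; split=> // x _.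
  by rewrite mul0mx /ev !linear0.
apply/U0P/JrightP; rewrite one_plus_mul; split.
  by rewrite memvD ?Jalg_mul // memvD.
move=> x Jx; rewrite 2!mulmxDl 2!evD uP // vP // -mulmxA uP ?Jalg_mul //.
by rewrite !addr0.
Qed.
Canonical U0_group lam := Group (U0_group_set lam).

Lemma stab_fix lam h : h \in stab lam -> Ad h lam = lam.
Proof.
case/stabP=> _ /(_ _ _ (group1 _) (group1 _)).
by rewrite lact1 ract1.
Qed.

Lemma U0_conj lam (u h : GL) : u \in U0 lam -> h \in stab lam ->
  mx (u ^ h)%g - 1 = mx h^-1%g *m (mx u - 1) *m mx h.
Proof.
move=> _ _; rewrite conjgE !mxM mulmxBr mulmx1 mulmxBl.
by rewrite -[in RHS]mulmxA -[X in _ = _ - X]mxM mulVg mx1.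
Qed.

Lemma stab_norm_U0 lam : stab lam \subset 'N(U0 lam).
Proof.
apply/subsetP=> h Hh; rewrite inE; apply/subsetP=> _ /imsetP[u Uu ->].
have [Lh _] := stabP _ _ Hh.
have Gh : h \in parabolic by apply: (subsetP levi_sub).
have Gh' := groupVr Gh; have Gh'' := groupVr Gh'.
apply/U0P/JrightP; rewrite (U0_conj Uu) //.
have /U0P/JrightP[Ju uP] := Uu; split=> [|x Jx].
  by rewrite Jalg_mulGr ?Jalg_mulGl.
have Jhx : mx h^-1%g *m (mx u - 1) *m mx h *m x \in Jalg.
  by apply: Jalg_mul => //; apply: Jalg_mulGr => //; apply: Jalg_mulGl.
have fix_lam := stab_fix (groupVr Hh).
rewrite -{1}fix_lam (AdE _ Gh' Jhx) invgK.
rewrite !mulmxA -mxM mulgV mx1 mul1mx -!mulmxA uP //.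
by rewrite mulmxA Jalg_mulGr ?Jalg_mulGl.
Qed.

Definition G0 (lam : Jdual) : {set GL} := (stab lam * U0 lam)%g.

Fact G0_group_set lam : group_set (G0 lam).
Proof. by apply/comm_group_setP/normC/stab_norm_U0. Qed.
Canonical G0_group lam := Group (G0_group_set lam).

Lemma levi_J1 (h : GL) : h \in levi -> mx h - 1 \in Jalg -> h = 1%g.
Proof.
move=> /leviP hP /JalgP h1P; apply/mx_inj/matrixP=> i j.
have [bij|bij] := leqP (b j) (b i).
  by apply/eqP; rewrite -subr_eq0; have := h1P i j bij; rewrite !mxE => ->.
have nbij : b i != b j by rewrite neq_ltn bij.
rewrite hP // mx1 mxE.
by case: (i =P j) bij => [->|//]; rewrite ltnn.
Qed.

Lemma stabI_U0 lam : stab lam :&: U0 lam = 1%g.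
Proof.
apply/trivgP/subsetP=> h /setIP[/stabP[Lh _] /U0P/JrightP[Jh _]].
by apply/set1P; apply: levi_J1 Lh Jh.
Qed.

Lemma U0sub lam : U0 lam \subset parabolic.
Proof.
apply/subsetP=> u /U0P/JrightP[/JalgP uP _]; apply/parabolicP=> i j bij.
rewrite -[mx u](subrK 1) mxE uP ?(ltnW bij) // add0r mxE.
by case: eqVneq bij => // ->; rewrite ltnn.
Qed.

Lemma G0_sub lam : G0 lam \subset parabolic.
Proof.
rewrite mul_subG ?U0sub //; apply: subset_trans levi_sub.
by apply/subsetP=> h /stabP[].
Qed.

Section Xi.

Variables (e : additive_character F) (lam : Jdual) (theta : 'CF(stab_group lam)).
Variable p : subg_of levi_group.

(* An element of G0 lam decomposes uniquely as h * u with h in stab lam and   *)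
(* u in U0 lam; divgr and remgr are the two projections.                      *)
Definition xi_fun (g : GL) : algC :=
  if g \in G0 lam then
    theta (divgr (stab lam) (U0 lam) g)
      * e (ev (lact (sgval p) lam) (mx (remgr (stab lam) (U0 lam) g) - 1))
  else 0.

Lemma addchar0 : e 0 = 1.
Proof.
have := addcharD e 0 0; rewrite addr0 => /esym/eqP.
by rewrite -{3}[e 0]mulr1 (inj_eq (mulfI (addchar_neq0 e 0))) => /eqP.
Qed.

Let plam := lact (sgval p) lam.

Fact psgG : sgval p \in parabolic.
Proof. exact: subsetP levi_sub _ (subgP p). Qed.

Fact Ad_plam h : h \in stab lam -> Ad h plam = plam.
Proof.
case/stabP=> _ /(_ _ _ psgG (group1 _)).
by rewrite ract1.
Qed.

Fact plam_U0 u v : u \in U0 lam -> v \in U0 lam ->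
  ev plam (mx (u * v)%g - 1) =
  ev plam (mx u - 1) + ev plam (mx v - 1).
Proof.
move=> /U0P/JrightP[Ju uP] /U0P/JrightP[Jv vP].
rewrite one_plus_mul !evD /plam (@lactE _ _ (_ *m _)) ?Jalg_mul //.
by rewrite -mulmxA uP ?addr0 // Jalg_mulGr ?psgG.
Qed.

Fact plam_conj u h : u \in U0 lam -> h \in stab lam ->
  ev plam (mx (u ^ h)%g - 1) = ev plam (mx u - 1).
Proof.
move=> Uu Hh; rewrite (U0_conj Uu) //.
have Gh : h \in parabolic by have /stabP[/(subsetP levi_sub)] := Hh.
have /U0P/JrightP[Ju _] := Uu.
by rewrite -[in RHS](Ad_plam Hh) AdE.
Qed.

Lemma xi_funE (h u : GL) : h \in stab lam -> u \in U0 lam ->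
  xi_fun (h * u)%g = theta h * e (ev plam (mx u - 1)).
Proof.
move=> Hh Uu; rewrite /xi_fun mem_mulg //.
by rewrite divgrMid ?remgrMid ?stabI_U0.
Qed.

Fact xi_fun_class : is_class_fun <<G0 lam>> [ffun g => xi_fun g].
Proof.
rewrite genGid; apply: intro_class_fun => [x y|x /negPf Gx]; last by rewrite /xi_fun Gx.
case/mulsgP=> h u Hh Uu -> /mulsgP[k v Hk Vv ->].
have nU := subsetP (stab_norm_U0 lam).
have Hhk : (h ^ k)%g \in stab lam by rewrite groupJ.
have U1 : (v^-1 ^ (h ^ k))%g \in U0 lam by rewrite memJ_norm ?groupV // nU.
have U2 : (u ^ k)%g \in U0 lam by rewrite memJ_norm // nU.
have -> : ((h * u) ^ (k * v) = h ^ k * ((v^-1 ^ (h ^ k) * u ^ k) * v))%g.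
  rewrite conjgM [((h * u) ^ k)%g]conjMg; move: (h ^ k)%g (u ^ k)%g => a c.
  by rewrite !conjgE !mulgA mulgV mul1g.
have U12 := groupM U1 U2; rewrite (xi_funE Hhk (groupM U12 Vv)) (xi_funE Hh Uu).
rewrite cfunJ //; congr (_ * e _).
rewrite (plam_U0 U12 Vv) (plam_U0 U1 U2) !plam_conj ?groupV // addrAC.
rewrite -plam_U0 ?groupV // mulVg.
by rewrite subrr /ev !linear0 add0r.
Qed.

Definition xi : 'CF(G0_group lam) := Cfun 0 xi_fun_class.

Lemma xiE (h u : GL) : h \in stab lam -> u \in U0 lam ->
  xi (h * u)%g = theta h * e (ev plam (mx u - 1)).
Proof. by move=> Hh Uu; rewrite cfunE xi_funE. Qed.

End Xi.

Definition Delta_J : {set root} := [set r : root | delta_mx r.1 r.2 \in Jalg].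

Definition rooks (Delta : {set root}) : {set {set root}} :=
  [set D : {set root} | (D \subset Delta) &&
     [forall r in D, forall s in D, ((r.1 == s.1) || (r.2 == s.2)) ==> (r == s)]].

Definition dnum (D : {set root}) (k m : 'I_l) : nat :=
  #|[set r in D | (b r.1 == k) && (b r.2 == m)]|.

Definition rook_equiv : rel {set root} := fun D D' =>
  [forall k : 'I_l, forall m : 'I_l, (k < m)%N ==> (dnum D k m == dnum D' k m)].

(* R contains exactly one element of each rook placement class in Delta.      *)
Definition rook_representatives (Delta : {set root}) (R : {set {set root}}) :=
  is_transversal R (equivalence_partition rook_equiv (rooks Delta)) (rooks Delta).

Definition xD (D : {set root}) : M := \sum_(r in D) delta_mx r.1 r.2.

Definition lamD (D : {set root}) : Jdual :=
  \sum_(r in D) linfun (fun x : subvs_of Jalg => vsval x r.1 r.2 : F^o).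

Definition HD (D : {set root}) : {group GL} := stab_group (lamD D).

Definition chi (e : additive_character F) (D : {set root}) (i : Iirr (HD D)) :
    'CF(parabolic_group) :=
  'Ind[parabolic_group, G0_group (lamD D)]
    (\sum_(p : subg_of levi_group) xi e 'chi[HD D]_i p).

Definition fixed_subspace (h : GL) (V : {vspace Jdual}) : Prop :=
  (forall g mu, g \in parabolic -> mu \in V -> lact g mu \in V /\ ract mu g \in V)
  /\ (forall mu, mu \in V -> Ad h mu = mu).

Lemma largest_fixed_subspace (h : GL) :
  {W : {vspace Jdual} | fixed_subspace h W
                      & forall V, fixed_subspace h V -> (V <= W)%VS}.
Proof.
pose f (g : GL * GL) (mu : Jdual) : Jdual :=
  Ad h (lact g.1 (ract mu g.2)) - lact g.1 (ract mu g.2).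
have f_lin g : linear (f g).
  move=> a mu nu; rewrite /f /Ad.
  rewrite !(ract_linear, lact_linear).
  by rewrite opprD addrACA scalerBr.
pose W : {vspace Jdual} := (\bigcap_(g : GL * GL | (g.1 \in parabolic)
    && (g.2 \in parabolic)) lker (linfun (f g)))%VS.
have WP mu : reflect (forall g1 g2, g1 \in parabolic -> g2 \in parabolic ->
    Ad h (lact g1 (ract mu g2)) = lact g1 (ract mu g2)) (mu \in W).
  have fE g : linfun (f g) mu = f g mu.
    pose f' := HB.pack_for {linear Jdual -> Jdual} (f g)
      (GRing.isLinear.Build _ _ _ _ _ (f_lin g)).
    exact: (lfunE f').
  rewrite memvE; apply: (iffP subv_bigcapP) => [muP g1 g2 Gg1 Gg2|muP [g1 g2]].
    have := muP (g1, g2); rewrite /= Gg1 Gg2 -memvE memv_ker fE => /(_ isT).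
    by rewrite subr_eq0 => /eqP.
  by case/andP=> Gg1 Gg2; rewrite -memvE memv_ker fE subr_eq0 muP.
exists W; first split.
- move=> g mu Gg /WP muP; split; apply/WP=> g1 g2 Gg1 Gg2.
    rewrite -(lractA _ Gg Gg2) (lactM _ _ Gg1).
    exact: muP (groupM Gg1 Gg) Gg2.
  by rewrite (ractM _ _ Gg2); apply: muP Gg1 (groupM Gg Gg2).
- by move=> mu /WP/(_ _ _ (group1 _) (group1 _)); rewrite lact1 ract1.
move=> V [VG Vh]; apply/subvP=> mu Vmu; apply/WP=> g1 g2 Gg1 Gg2.
by apply: Vh; apply: (VG _ _ Gg1 _).1; apply: (VG _ _ Gg2 _).2.
Qed.

Definition Wh (h : GL) : {vspace Jdual} := s2val (largest_fixed_subspace h).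

Definition Jh (h : GL) : {set M} :=
  [set x in Jalg | [forall mu : finvect_type Jdual, (mu \in Wh h) ==> (ev mu x == 0)]].

Definition Delta_h (h : GL) : {set root} :=
  [set r in Delta_J | delta_mx r.1 r.2 \notin Jh h].

(* The quotient J / J_h consists of the cosets of J_h, as sets of matrices.   *)
Definition pi_h (h : GL) (x : M) : {set M} := [set y in Jalg | y - x \in Jh h].

Definition omega (h : GL) (D : {set root}) : {set {set M}} :=
  [set pi_h h (mx g1 *m xD D *m mx g2) 
     | g1 : GL in parabolic, g2 : GL in parabolic].

Definition Kclass (h : GL) (D : {set root}) : {set GL} :=
  ((h ^: levi) * one_plus [set x in Jalg | pi_h h x \in omega h D])%g.

End Parabolic.

Arguments chi {F n l b} e D i.

(* Main.v *)
Require Import Defs.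
From HB Require Import structures.
From mathcomp Require Import all_boot all_order all_algebra all_fingroup.
From mathcomp Require Import all_solvable all_field all_character.
From mathcomp Require Import ring.

Set Implicit Arguments.
Unset Strict Implicit.
Unset Printing Implicit Defensive.

Import Order.TTheory GRing.Theory Num.Theory GroupScope.
Local Open Scope ring_scope.

(** Every element of G is uniquely h (1 + x) with h in L and x in J.  The whole
    proof is the computation, for alpha = (theta, D) and lam = lam_D, of
[[
      chi_alpha (h (1 + x)) = c_D theta(h) Phi_D(x),
      Phi_D(x) = sum over a, c in G of e (lam (a x c)),
]]
    where c_D > 0 depends on D only and theta(h) stands for 0 when h is not in
    H(D) ([induced_xiE], [chiE]).  Three facts produce this shape.

    - Inducing e o lam from 1 + J_right averages over the right orbit: the sum
      over c in G of e (lam (z c)) vanishes unless z lies in J_right, and then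
      it is a multiple of the sum over p in L ([sum_right_orbit]).  So the sum
      over p in the definition of chi_alpha completes right U-orbits to G-orbits.
    - For h in H(D) the commutators of h with U only create terms on which every
      form of the orbit G lam G vanishes ([conjg_levi_unip]), so x is not
      disturbed by h.
    - An element of L acts on H(D) by conjugation as an element of H(D) does
      ([HD_conj]), hence theta is L-invariant and factors out.

    Phi_D(x) depends only on the G x G orbit of x, and, for h in H(D), only on
    this orbit modulo J_h, because lam_D vanishes on J_h.  Thus the characters
    are constant on the classes.  Their inner products factor as a sum over L
    times a sum over J.  If D and D' are inequivalent the second factor is 0: it
    is a sum of terms, each the sum over J of e of a linear form, and this form
    is nonzero as lam_D and lam_D' have different orbits.  If D = D' the first
    factor is the inner product of two irreducible characters of H(D).

    The sets K_beta cover G because Gaussian elimination by upper triangular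
    matrices brings every x to some x_D ([rook_normal_form]), and L x L permutes
    the x_D with the same block counts ([rook_equiv_conj]).  They are disjoint
    because these block counts are recovered from ranks of corner submatrices,
    which are invariants of the orbit even modulo J_h ([rook_equiv_mod]); the
    opposite corners separate the orbits of the lam_D ([lamD_orbit_equiv]).

    There are as many characters as classes: both numbers count the pairs (h, D)
    with h in H(D).  Indeed the conjugacy classes of H(D) are the classes of L
    contained in it, and h is in H(D) exactly when D is contained in Delta_h
    ([card_classes_HD], [card_reps_Delta_h]).

    What makes J_h, Delta_h and H(D) computable is [bimodule_root]: a subspace
    of J that is stable under G on both sides and contains all the commutators
    xh - hx contains each matrix unit whose block interval carries a nonscalar
    part of h. *)

(** * Matrix units and the parabolic group *)

Section Matrices.

Variables (F : finFieldType) (n l : nat) (b : 'I_n.+1 -> 'I_l).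

Local Notation M := 'M[F]_n.+1.
Local Notation GL := (GLn F n).
Local Notation root := ('I_n.+1 * 'I_n.+1)%type.
Local Notation J := (Jalg F b).
Local Notation G := (parabolic F b).
Local Notation L := (levi F b).

Lemma GL_of_unit (A : M) : A \in unitmx -> {g : GL | mx g = A}.
Proof. by move=> uA; exists (FinRing.Unit uA). Qed.

Lemma mxVl (g : GL) : mx g^-1%g *m mx g = 1%:M.
Proof. by rewrite -mxM mulVg mx1. Qed.

Lemma mxVr (g : GL) : mx g *m mx g^-1%g = 1%:M.
Proof. by rewrite -mxM mulgV mx1. Qed.

Lemma Jalg_bimul (g1 g2 : GL) (x : M) : g1 \in G -> g2 \in G -> x \in J ->
  mx g1 *m x *m mx g2 \in J.
Proof. by move=> G1 G2 Jx; rewrite Jalg_mulGr ?Jalg_mulGl. Qed.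

Lemma levi_parabolic (g : GL) : g \in L -> g \in G.
Proof. exact: (subsetP (levi_sub F b)). Qed.

Lemma delta_mulE m p q (A : 'M[F]_(p, q)) (i : 'I_m) (j : 'I_p) r s :
  (delta_mx i j *m A) r s = (r == i)%:R * A j s.
Proof.
rewrite mxE (bigD1 j) //= big1 ?addr0 => [|k /negPf kj]; rewrite mxE ?eqxx ?andbT //.
by rewrite kj andbF mul0r.
Qed.

Lemma mul_deltaE m p q (A : 'M[F]_(m, p)) (i : 'I_p) (j : 'I_q) r s :
  (A *m delta_mx i j) r s = A r i * (s == j)%:R.
Proof.
rewrite mxE (bigD1 i) //= big1 ?addr0 => [|k /negPf kj]; rewrite mxE ?eqxx //.
by rewrite kj mulr0.
Qed.

Lemma delta_mul_delta (A : M) (i r s j : 'I_n.+1) :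
  delta_mx i r *m A *m delta_mx s j = A r s *: delta_mx i j.
Proof.
apply/matrixP=> p q; rewrite mul_deltaE delta_mulE !mxE mulrC mulrA mulrC.
by rewrite -natrM mulnb andbC.
Qed.

Lemma mul_delta_mulE (A B : M) (r s i j : 'I_n.+1) :
  (A *m delta_mx r s *m B) i j = A i r * B s j.
Proof.
rewrite -mulmxA mxE (bigD1 r) //= big1 ?addr0 => [|k /negPf kr].
  by rewrite delta_mulE eqxx mul1r.
by rewrite delta_mulE kr mul0r mulr0.
Qed.

Lemma delta_J i j : (delta_mx i j \in J) = (b i < b j)%N.
Proof.
apply/JalgP/idP => [|bij r s brs].
  by move/(_ i j); rewrite mxE !eqxx ltnNge; case: leqP => // _ /(_ isT)/eqP; rewrite oner_eq0.
rewrite mxE; case: andP => // -[/eqP ri /eqP sj]; move: brs.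
by rewrite ri sj leqNgt bij.
Qed.

(** Diagonal matrix units need not lie in the span of G (for instance when F has two
    elements and the blocks have size 1), so stability under G is exploited through
    these transvections only. *)
Lemma transvection (i j : 'I_n.+1) : i != j -> (b i <= b j)%N ->
  exists2 g : GL, g \in G & mx g = 1%:M + delta_mx i j.
Proof.
move=> ij bij; have dd : delta_mx i j *m delta_mx i j = 0 :> M.
  by apply/matrixP=> r s; rewrite delta_mulE !mxE [j == i]eq_sym (negPf ij) mulr0.
have uA : 1%:M + delta_mx i j \in @unitmx F n.+1.
  apply: (proj1 (mulmx1_unit (B := 1%:M - delta_mx i j) _)).
  by rewrite mulmxDl !mulmxBr !mulmx1 !mul1mx dd subr0 subrK.
have [g gE] := GL_of_unit uA; exists g => //.
apply/parabolicP=> r s brs; rewrite gE !mxE.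
have [rs|_] := eqVneq r s; first by move: brs; rewrite rs ltnn.
rewrite add0r; case: andP => // -[/eqP ri /eqP sj]; move: brs.
by rewrite ri sj ltnNge bij.
Qed.

End Matrices.

(** * The decomposition of G into Levi and unipotent parts *)

Section Unipotent.

Variables (F : finFieldType) (n l : nat) (b : 'I_n.+1 -> 'I_l).

Local Notation M := 'M[F]_n.+1.
Local Notation GL := (GLn F n).
Local Notation J := (Jalg F b).
Local Notation G := (parabolic F b).
Local Notation L := (levi F b).

Definition unip : {set GL} := one_plus [set x in J].
Local Notation U := unip.

Lemma unipP (u : GL) : reflect (mx u - 1 \in J) (u \in U).
Proof. by rewrite !inE; apply: idP. Qed.

Lemma unip_group_set : group_set U.
Proof.
apply/group_setP; split=> [|u v /unipP Ju /unipP Jv]; apply/unipP.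
  by rewrite mx1 subrr mem0v.
by rewrite one_plus_mul memvD ?Jalg_mul // memvD.
Qed.
Canonical unip_group := Group unip_group_set.

Lemma unip_parabolic (u : GL) : u \in U -> u \in G.
Proof.
move=> /unipP/JalgP uP; apply/parabolicP=> i j bij.
rewrite -[mx u](subrK 1) mxE uP ?(ltnW bij) // add0r mxE.
by case: eqVneq bij => // ->; rewrite ltnn.
Qed.

Lemma mx_conj1 (u g : GL) : mx (u ^ g)%g - 1 = mx g^-1%g *m (mx u - 1) *m mx g.
Proof.
rewrite conjgE !mxM mulmxBr mulmx1 mulmxBl.
by rewrite -[in RHS]mulmxA -[X in _ = _ - X]mxM mulVg mx1.
Qed.

Lemma unip_norm (u g : GL) : u \in U -> g \in G -> (u ^ g)%g \in U.
Proof. by move=> /unipP Ju Gg; apply/unipP; rewrite mx_conj1 Jalg_bimul ?groupV. Qed.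

Definition diag_part (A : M) : M :=
  \matrix_(i, j) if b i == b j then A i j else 0.

(** On block triangular matrices, taking the diagonal blocks is a ring morphism;
    applied to g and its inverse it shows that the diagonal part of g is
    invertible. *)
Lemma diag_partM (g k : GL) : g \in G -> k \in G ->
  diag_part (mx (g * k)%g) = diag_part (mx g) *m diag_part (mx k).
Proof.
move=> /parabolicP gP /parabolicP kP; apply/matrixP=> i j; rewrite mxM !mxE.
case: eqP => [bij|nbij].
  apply: eq_bigr => a _; rewrite !mxE -bij eq_sym; case: eqVneq => // nba.
  rewrite mulr0; move: nba; rewrite neq_ltn => /orP[ba|ba].
    by rewrite gP ?mul0r.
  by rewrite kP ?mulr0 // -bij.
rewrite big1 // => a _; rewrite !mxE; case: eqP => [bia|]; last by rewrite mul0r.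
by case: eqP => [baj|_]; [case: nbij; rewrite bia | rewrite mulr0].
Qed.

Lemma diag_part1 : diag_part 1 = 1%:M.
Proof.
apply/matrixP=> i j; rewrite !mxE; case: eqP => // nbij.
by case: eqP => // eij; rewrite eij in nbij.
Qed.

Lemma parabolicLU (g : GL) : g \in G ->
  exists h u : GL, [/\ h \in L, u \in U & g = (h * u)%g].
Proof.
move=> Gg; have Gg' := groupVr Gg.
have uA : diag_part (mx g) \in unitmx.
  by have := diag_partM Gg Gg'; rewrite mulgV mx1 diag_part1 => /esym/mulmx1_unit[].
have [h hE] := GL_of_unit uA.
have Lh : h \in L.
  by apply/leviP => i j nbij; rewrite hE mxE (negPf nbij).
exists h, (h^-1 * g)%g; rewrite mulKVg; split=> //.
have Gh := levi_parabolic Lh; have Gh' := groupVr Gh.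
have dh : diag_part (mx h^-1%g) = mx h^-1%g.
  apply/matrixP=> i j; rewrite mxE; case: eqVneq => // nbij.
  by have /leviP-> := groupVr Lh.
have /parabolicP hgP : (h^-1 * g)%g \in G by rewrite groupM.
apply/unipP/JalgP=> i j; rewrite leq_eqVlt => /orP[/eqP/val_inj bij|bij].
  have := diag_partM Gh' Gg; rewrite dh -hE -mxM mulVg mx1 => /matrixP/(_ i j).
  by rewrite [in LHS]mxE bij eqxx => hg1; rewrite mxE hg1 [X in _ + X]mxE addrN.
rewrite mxE hgP // add0r !mxE; case: eqVneq bij => [->|_ _]; first by rewrite ltnn.
by rewrite oppr0.
Qed.

Lemma LU_inj (h u k v : GL) : h \in L -> u \in U -> k \in L -> v \in U ->
  (h * u = k * v)%g -> h = k /\ u = v.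
Proof.
move=> Lh Uu Lk Uv e; suff hk : h = k by split=> //; move: e; rewrite hk => /mulgI.
have e1 : (k^-1 * h = v * u^-1)%g.
  by apply: (mulIg u); rewrite mulgKV -mulgA e mulKg.
suff : (k^-1 * h = 1)%g by move/eqP; rewrite -eq_mulVg1 => /eqP.
apply: (@levi_J1 F n l b); first by rewrite groupM ?groupV.
by rewrite e1; apply/unipP; rewrite groupM ?groupV.
Qed.

Lemma LU_parabolic (h u : GL) : h \in L -> u \in U -> (h * u)%g \in G.
Proof. by move=> Lh Uu; rewrite groupM ?(levi_parabolic Lh) ?unip_parabolic. Qed.

Lemma sum_parabolic (V : nmodType) (f : GL -> V) :
  \sum_(g in G) f g = \sum_(h in L) \sum_(u in U) f (h * u)%g.
Proof.
rewrite pair_big /=.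
have -> : G = [set (p.1 * p.2)%g | p in [pred p : GL * GL | (p.1 \in L) && (p.2 \in U)]].
  apply/setP=> g; apply/idP/imsetP=> [/parabolicLU[h [u [Lh Uu ->]]]|[[h u] /andP[Lh Uu] ->]].
    by exists (h, u); rewrite // inE Lh Uu.
  exact: LU_parabolic.
rewrite big_imset //= => -[h u] [k v] /andP[Lh Uu] /andP[Lk Uv] /=.
by case/LU_inj=> //= -> ->.
Qed.

Hypothesis b_mono : forall i j : 'I_n.+1, (i <= j)%N -> (b i <= b j)%N.

Lemma unip_surj (x : M) : x \in J -> exists2 u : GL, u \in U & mx u = 1 + x.
Proof.
move=> Jx; have [u uE] := GL_of_unit (one_plus_unit b_mono Jx).
by exists u => //; apply/unipP; rewrite uE addrC addKr.
Qed.

(** Sums over U become sums over the vector space J, where linear forms and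
    additive characters live. *)
Lemma sum_unip (V : nmodType) (f : M -> V) :
  \sum_(u in U) f (mx u - 1) = \sum_(x in J) f x.
Proof.
rewrite -(big_imset f (h := fun u : GL => mx u - 1) (A := U)) /=.
  apply: eq_bigl => x; apply/imsetP/idP => [[u /unipP Ju -> //]|/unip_surj[u Uu uE]].
  by exists u; rewrite // uE addrC addKr.
by move=> u v _ _ /(congr1 (fun y => y + 1)); rewrite !subrK => /mx_inj.
Qed.

End Unipotent.

(** * Segments of blocks on which h is scalar *)

Section ScalarBlocks.

Variables (F : finFieldType) (n l : nat) (b : 'I_n.+1 -> 'I_l).

Local Notation M := 'M[F]_n.+1.
Local Notation GL := (GLn F n).
Local Notation J := (Jalg F b).
Local Notation G := (parabolic F b).
Local Notation L := (levi F b).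

Definition scalar_on (h : GL) (k m : nat) : bool :=
  [exists c : F, forall r, forall s,
     (k <= b r <= m)%N ==> (mx h r s == c *+ (r == s))].

Lemma scalar_onP h k m :
  reflect (exists c, forall r s, (k <= b r <= m)%N -> mx h r s = c *+ (r == s))
          (scalar_on h k m).
Proof.
apply: (iffP existsP) => -[c cP]; exists c.
  by move=> r s rkm; have /forallP/(_ r)/forallP/(_ s)/implyP/(_ rkm)/eqP := cP.
by apply/forallP=> r; apply/forallP=> s; apply/implyP=> rkm; rewrite cP.
Qed.

Lemma scalar_on_sub h k m k' m' : (k <= k')%N -> (m' <= m)%N ->
  scalar_on h k m -> scalar_on h k' m'.
Proof.
move=> kk mm /scalar_onP[c cP]; apply/scalar_onP; exists c => r s /andP[kr rm].
by rewrite cP // (leq_trans kk) // (leq_trans rm).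
Qed.

(** If h is not scalar on the segment from the block of i to that of j, either h
    has a nonzero off-diagonal entry in this segment or two of its diagonal
    entries there differ.  In both cases a commutator of h with a suitable matrix
    unit, multiplied by transvections, is a nonzero multiple of the matrix unit
    at (i, j). *)
Lemma bimodule_root (N : {pred M}) (h : GL) (i j : 'I_n.+1) :
    h \in L ->
    (forall x y, x \in N -> y \in N -> x - y \in N) ->
    (forall c x, x \in N -> c *: x \in N) ->
    (forall g x, g \in G -> x \in N -> mx g *m x \in N) ->
    (forall g x, g \in G -> x \in N -> x *m mx g \in N) ->
    (forall x, x \in J -> x *m mx h - mx h *m x \in N) ->
    (b i < b j)%N -> ~~ scalar_on h (b i) (b j) -> delta_mx i j \in N.
Proof.
move=> /leviP Lh NB NZ NGl NGr Nh bij nsc.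
have Nl a r x : a != r -> (b a <= b r)%N -> x \in N -> delta_mx a r *m x \in N.
  move=> ar bar Nx; have [g Gg gE] := transvection F ar bar.
  by rewrite -[_ *m _](addKr x) addrC NB // -[X in X + _]mul1mx -mulmxDl -gE NGl.
have Nr a r x : a != r -> (b a <= b r)%N -> x \in N -> x *m delta_mx a r \in N.
  move=> ar bar Nx; have [g Gg gE] := transvection F ar bar.
  by rewrite -[_ *m _](addKr x) addrC NB // -[X in X + _]mulmx1 -mulmxDr -gE NGr.
have NV c x : c != 0 -> c *: x \in N -> x \in N.
  by move=> c0 /(NZ c^-1); rewrite scalerA mulVf // scale1r.
have ddE (a r s : 'I_n.+1) : delta_mx a r *m delta_mx r s = delta_mx a s :> M.
  by rewrite mul_delta_mx.
(* A nonzero off-diagonal entry h r s: move it to (i, j) along row i or column j,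
   according to whether the block of r comes before that of j. *)
case: (boolP [exists r, exists s, [&& r != s, (b i <= b r <= b j)%N & mx h r s != 0]]).
  case/existsP=> r /existsP[s /and3P[rs /andP[ir rj] hrs]].
  have brs : b r = b s by apply: contraNeq hrs => nb; rewrite Lh.
  have [rltj|] := ltnP (b r) (b j).
    have Nrj : delta_mx r j \in N -> delta_mx i j \in N.
      by have [->//|nir] := eqVneq i r; rewrite -(ddE i r j); apply: Nl.
    have [ir_eq|nir] := eqVneq i r; last first.
      apply: (NV (- mx h r s)); first by rewrite oppr_eq0.
      have Jx : delta_mx s j \in J by rewrite delta_J -brs.
      have := Nl _ _ _ nir ir (Nh _ Jx); rewrite mulmxBr !mulmxA mul_delta_mx_0 //.
      by rewrite mul0mx sub0r delta_mul_delta scaleNr.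
    subst r; rewrite -(ddE i s j); apply: (Nl) => //; first by rewrite brs.
    apply: (NV (- mx h i s)); first by rewrite oppr_eq0.
    have Jx : delta_mx s j \in J by rewrite delta_J -brs.
    have bsi : (b s <= b i)%N by rewrite brs.
    have nsi : s != i by rewrite eq_sym.
    have := Nl _ _ _ nsi bsi (Nh _ Jx); rewrite mulmxBr !mulmxA mul_delta_mx_0 //.
    by rewrite mul0mx sub0r delta_mul_delta scaleNr.
  move=> jr; have bi_r : (b i < b r)%N by apply: leq_trans jr.
  have Jx : delta_mx i r \in J by rewrite delta_J.
  have col k : k != s -> (b s <= b k)%N -> mx h r s *: delta_mx i k \in N.
    move=> ks bsk; have := Nr _ _ _ (_ : s != k) bsk (Nh _ Jx).
    rewrite eq_sym => /(_ ks); rewrite mulmxBl -[mx h *m _ *m _]mulmxA mul_delta_mx_0 //.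
    by rewrite mulmx0 subr0 delta_mul_delta.
  have [sj|nsj] := eqVneq s j; last first.
    by apply: (NV _ _ hrs); apply: col; rewrite 1?eq_sym // -brs.
  subst s; rewrite -(ddE i r j); apply: (Nr) => //.
  by apply: (NV _ _ hrs); apply: col => //; rewrite brs.
(* Now h is diagonal on the segment, so that the commutator of h with the matrix
   unit at (r, s) is a multiple of this matrix unit. *)
rewrite negb_exists => /forallP diag_h.
have dh r s : (b i <= b r <= b j)%N -> r != s -> mx h r s = 0.
  move=> rij rs; have := diag_h r; rewrite negb_exists => /forallP/(_ s).
  by rewrite rs rij /= negbK => /eqP.
have dh' r s : (b i <= b r <= b j)%N -> r != s -> mx h s r = 0.
  move=> rij rs; have [brs|nb] := eqVneq (b r) (b s).
    by rewrite dh // -?brs // eq_sym.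
  by rewrite Lh // eq_sym.
have NE r s : (b i <= b r)%N -> (b r < b s)%N -> (b s <= b j)%N ->
    mx h s s != mx h r r -> delta_mx r s \in N.
  move=> ir rs sj; rewrite -subr_eq0 => /NV; apply.
  have Jx : delta_mx r s \in J by rewrite delta_J.
  have := Nh _ Jx; congr (_ \in N); apply/matrixP=> p q.
  rewrite mxE [X in _ + X]mxE delta_mulE mul_deltaE !mxE.
  have rij : (b i <= b r <= b j)%N by rewrite ir (leq_trans (ltnW rs)).
  have sij : (b i <= b s <= b j)%N by rewrite sj (leq_trans ir) // ltnW.
  have [->|pr] := eqVneq p r; have [->|qs] := eqVneq q s; rewrite ?(mul1r, mulr1, mul0r, mulr0, subrr, subr0) //=.
    by rewrite dh // eq_sym.
  by rewrite dh' ?oppr0 ?add0r // eq_sym.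
have [p pij hp] : exists2 p, (b i <= b p <= b j)%N & mx h p p != mx h i i.
  apply/exists_inP; apply: contraNT nsc; rewrite negb_exists_in => /forall_inP hP.
  apply/scalar_onP; exists (mx h i i) => r s rij; have [<-|rs] := eqVneq r s.
    by apply/eqP; have := hP _ rij; rewrite negbK.
  by rewrite dh.
have main a : (b i < b a)%N -> (b a <= b j)%N -> mx h a a != mx h i i ->
    delta_mx i j \in N.
  move=> ia aj hai; have Nia := NE i a (leqnn _) ia aj hai.
  by have [<-//|naj] := eqVneq a j; rewrite -(ddE i a j); apply: Nr.
(* Either j, or p in a block after that of i, has a diagonal entry other than that
   of i; or p is in the block of i and its entry differs from that of j. *)
have [hj|hj] := eqVneq (mx h j j) (mx h i i); last exact: main hj.
have /andP[] := pij; rewrite leq_eqVlt => /orP[/eqP bip _|ip pj]; last exact: main hp.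
have nip : i != p by apply: contraNneq hp => ->.
by rewrite -(ddE i p j); apply: Nl; rewrite ?bip //; apply: NE; rewrite -?bip // hj eq_sym.
Qed.


End ScalarBlocks.

(** * Explicit forms of J_h and H(D) *)

Section Explicit.

Variables (F : finFieldType) (n l : nat) (b : 'I_n.+1 -> 'I_l).

Local Notation M := 'M[F]_n.+1.
Local Notation GL := (GLn F n).
Local Notation root := ('I_n.+1 * 'I_n.+1)%type.
Local Notation J := (Jalg F b).
Local Notation G := (parabolic F b).
Local Notation L := (levi F b).
Local Notation Jdual := 'Hom(subvs_of J, F^o).

Lemma evB (mu : Jdual) (x y : M) : ev mu (x - y) = ev mu x - ev mu y.
Proof. by rewrite /ev !linearB. Qed.

Lemma evZ (mu : Jdual) c (x : M) : ev mu (c *: x) = c * ev mu x.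
Proof. by rewrite /ev !linearZ. Qed.

Lemma ev0 (mu : Jdual) : ev mu 0 = 0.
Proof. by rewrite /ev !linear0. Qed.

Lemma ev_sum (I : finType) (P : pred I) (mu : Jdual) (f : I -> M) :
  ev mu (\sum_(i | P i) f i) = \sum_(i | P i) ev mu (f i).
Proof. by rewrite /ev !linear_sum. Qed.

Lemma ev_coord (r : root) (x : M) : x \in J ->
  ev (linfun (fun y : subvs_of J => vsval y r.1 r.2 : F^o)) x = x r.1 r.2.
Proof.
move=> Jx; rewrite /ev.
have lin : linear (fun y : subvs_of J => vsval y r.1 r.2 : F^o).
  by move=> a u v; rewrite linearP /= !mxE.
pose f := HB.pack_for {linear subvs_of J -> F^o}
  (fun y : subvs_of J => vsval y r.1 r.2 : F^o)
  (GRing.isLinear.Build _ _ _ _ _ lin).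
by rewrite (lfunE f) /= vsprojK.
Qed.

Lemma ev_lamD (D : {set root}) (x : M) : x \in J ->
  ev (lamD F b D) x = \sum_(r in D) x r.1 r.2.
Proof.
move=> Jx; rewrite /ev /lamD sum_lfunE; apply: eq_bigr => r _.
exact: ev_coord.
Qed.

(** This is the explicit description of J_h, see [JhE].  It is phrased through the
    pairs of blocks on which h is scalar, which makes its stability under G
    immediate. *)
Definition null_part (h : GL) : {set M} :=
  [set x in J | [forall i, forall j, scalar_on b h (b i) (b j) ==> (x i j == 0)]].

Lemma null_partP h x :
  reflect (x \in J /\ forall i j, scalar_on b h (b i) (b j) -> x i j = 0)
          (x \in null_part h).
Proof.
rewrite [x \in null_part h]inE; apply: (iffP andP) => -[Jx xP]; split=> //.
  by move=> i j sij; have /forallP/(_ i)/forallP/(_ j)/implyP/(_ sij)/eqP := xP.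
by apply/forallP=> i; apply/forallP=> j; apply/implyP=> sij; rewrite xP.
Qed.

Lemma null_partB h x y : x \in null_part h -> y \in null_part h ->
  x - y \in null_part h.
Proof.
move=> /null_partP[Jx xP] /null_partP[Jy yP]; apply/null_partP.
by split=> [|i j sij]; rewrite ?memvB // !mxE xP ?yP ?subr0.
Qed.

Lemma null_part0 h : 0 \in null_part h.
Proof. by apply/null_partP; split=> [|i j _]; rewrite ?mem0v ?mxE. Qed.

Lemma null_part_mulGr h x g : x \in null_part h -> g \in G ->
  x *m mx g \in null_part h.
Proof.
move=> /null_partP[Jx xP] Gg; apply/null_partP; split; first exact: Jalg_mulGr.
move=> i j sij; rewrite mxE big1 // => k _.
have [bkj|bjk] := leqP (b k) (b j); last by have /parabolicP-> := Gg; rewrite ?mulr0.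
by rewrite xP ?mul0r //; apply: scalar_on_sub sij.
Qed.

Lemma null_part_mulGl h x g : x \in null_part h -> g \in G ->
  mx g *m x \in null_part h.
Proof.
move=> /null_partP[Jx xP] Gg; apply/null_partP; split; first exact: Jalg_mulGl.
move=> i j sij; rewrite mxE big1 // => k _.
have [bik|bki] := leqP (b i) (b k); last by have /parabolicP-> := Gg; rewrite ?mul0r.
by rewrite xP ?mulr0 //; apply: scalar_on_sub sij.
Qed.

Lemma commutator_null_part h x : h \in L -> x \in J ->
  x *m mx h - mx h *m x \in null_part h.
Proof.
move=> Lh Jx; have Gh := levi_parabolic Lh; apply/null_partP; split.
  by rewrite memvB ?Jalg_mulGl ?Jalg_mulGr.
move=> i j /scalar_onP[c cP].
have [bij|bji] := ltnP (b i) (b j); last first.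
  by have /JalgP-> // : x *m mx h - mx h *m x \in J by rewrite memvB ?Jalg_mulGl ?Jalg_mulGr.
rewrite !mxE [X in X + _](bigD1 j) //= [X in _ - X](bigD1 i) //=.
rewrite !big1 => [|k ki|k kj].
- by rewrite !cP ?leqnn ?(ltnW bij) // !eqxx mulr1n !addr0 mulrC subrr.
- by rewrite cP ?leqnn ?(ltnW bij) // eq_sym (negPf ki) mul0r.
have [bkj|nb] := eqVneq (b k) (b j).
  by rewrite cP ?(negPf kj) ?mulr0 // bkj leqnn (ltnW bij).
by have /leviP-> := Lh; rewrite ?mulr0.
Qed.

(** The bridge between the action of h on the orbit of mu and the entries of h:
    the vectors killed by the whole orbit of mu form a G-stable subspace, which
    contains the commutators with h exactly when h fixes this orbit. *)
Lemma stab_null h (mu : Jdual) : h \in L ->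
  reflect (forall y, y \in null_part h -> ev mu y = 0) (h \in stab mu).
Proof.
move=> Lh; have Gh := levi_parabolic Lh; have Gh' := groupVr Gh.
apply: (iffP (stabP mu h)) => [[_ fix_h] x /null_partP[Jx xP] | null_mu]; last first.
  split=> // g1 g2 G1 G2; apply: dualP=> y Jy; have Jhy := Jalg_mulGl Jy Gh'.
  have Jhyh := Jalg_mulGr Jhy Gh.
  rewrite AdE // !lactE // !Defs.ractE ?Jalg_mulGr //; apply/eqP.
  rewrite -subr_eq0 -evB -mulmxBr -mulmxBl; apply/eqP/null_mu.
  rewrite null_part_mulGl ?null_part_mulGr //.
  by have := commutator_null_part Lh Jhy; rewrite !mulmxA mxVr mul1mx.
(* N is the common kernel of the forms in the orbit of mu. *)
pose N : {pred M} := [pred y in J | [forall g1 in G, forall g2 in G,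
  ev mu (mx g1 *m y *m mx g2) == 0]].
have NP y : reflect (y \in J /\ forall g1 g2, g1 \in G -> g2 \in G ->
    ev mu (mx g1 *m y *m mx g2) = 0) (y \in N).
  apply: (iffP andP) => -[Jy yP]; split=> //.
    by move=> g1 g2 G1 G2; have /forall_inP/(_ g1 G1)/forall_inP/(_ g2 G2)/eqP := yP.
  by apply/forall_inP=> g1 G1; apply/forall_inP=> g2 G2; rewrite yP.
have Nroot i j : (b i < b j)%N -> ~~ scalar_on b h (b i) (b j) -> delta_mx i j \in N.
  apply: bimodule_root => //.
  - move=> u v /NP[Ju uP] /NP[Jv vP]; apply/NP; split=> [|g1 g2 G1 G2]; first exact: memvB.
    by rewrite mulmxBr mulmxBl evB uP // vP // subr0.
  - move=> c u /NP[Ju uP]; apply/NP; split=> [|g1 g2 G1 G2]; first exact: memvZ.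
    by rewrite -scalemxAr -scalemxAl evZ uP // mulr0.
  - move=> g u Gg /NP[Ju uP]; apply/NP; split=> [|g1 g2 G1 G2]; first exact: Jalg_mulGl.
    by rewrite mulmxA -mxM uP // groupM.
  - move=> g u Gg /NP[Ju uP]; apply/NP; split=> [|g1 g2 G1 G2]; first exact: Jalg_mulGr.
    by rewrite mulmxA -mulmxA -mxM uP // groupM.
  move=> y Jy; apply/NP; split=> [|g1 g2 G1 G2].
    by rewrite memvB ?Jalg_mulGl ?Jalg_mulGr.
  have Jhy := Jalg_mulGl Jy Gh; have Jyh := Jalg_mulGr Jy Gh.
  have := fix_h _ _ G2 G1 => /(congr1 (fun nu => ev nu (mx h *m y))).
  rewrite /= AdE // !mulmxA mxVl mul1mx !lactE // !Defs.ractE ?Jalg_mulGr //.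
  rewrite mulmxBr mulmxBl evB !mulmxA => ->.
  by rewrite subrr.
rewrite (matrix_sum_delta x) ev_sum big1 // => i _.
rewrite ev_sum big1 // => j _; rewrite evZ.
have [bij|bji] := ltnP (b i) (b j); last by have /JalgP-> := Jx; rewrite ?mul0r.
have [/xP->|/(Nroot _ _ bij)/NP[_ /(_ 1%g 1%g)]] := boolP (scalar_on b h (b i) (b j)).
  by rewrite mul0r.
by rewrite mx1 mul1mx mulmx1 => ->; rewrite ?mulr0 ?group1.
Qed.

(** The annihilator V of [null_part] is a fixed subspace, so it lies in the largest
    one; conversely every form in the largest fixed subspace has h in its
    stabilizer, hence vanishes on [null_part] by [stab_null]. *)
Lemma JhE h : h \in L -> Jh b h = null_part h.
Proof.
move=> Lh.
have [Wfix Wmax] := (s2valP (largest_fixed_subspace b h), s2valP' (largest_fixed_subspace b h)).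
rewrite -/(Wh b h) in Wfix Wmax.
have JhP x : reflect (x \in J /\ forall mu, mu \in Wh b h -> ev mu x = 0) (x \in Jh b h).
  rewrite [x \in Jh b h]inE; apply: (iffP andP) => -[Jx xP]; split=> //.
    by move=> mu Wmu; have /forallP/(_ mu)/implyP/(_ Wmu)/eqP := xP.
  by apply/forallP=> mu; apply/implyP=> Wmu; rewrite xP.
apply/setP=> x; apply/JhP/idP=> [[Jx xP]|/[dup]Nx /null_partP[Jx xP]]; last first.
  split=> // mu Wmu; have hmu : h \in stab mu.
    apply/stabP; split=> // g1 g2 G1 G2; apply: Wfix.2.
    by apply: (Wfix.1 _ _ _ _).1 => //; apply: (Wfix.1 _ _ _ _).2.
  exact: (stab_null mu Lh hmu).
apply/null_partP; split=> // i j sij.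
pose evx (y : M) (mu : Jdual) : F^o := ev mu y.
have lin y : linear (evx y) by move=> a u v; rewrite /evx /ev add_lfunE scale_lfunE.
pose V : {vspace Jdual} := (\bigcap_(y in null_part h) lker (linfun (evx y)))%VS.
have VP mu : reflect (forall y, y \in null_part h -> ev mu y = 0) (mu \in V).
  have fE y : linfun (evx y) mu = evx y mu.
    pose f := HB.pack_for {linear Jdual -> F^o} (evx y)
      (GRing.isLinear.Build _ _ _ _ _ (lin y)).
    exact: (lfunE f).
  rewrite memvE; apply: (iffP subv_bigcapP) => [muP y Ny|muP y Ny].
    by have := muP y Ny; rewrite -memvE memv_ker fE => /eqP.
  by rewrite -memvE memv_ker fE /evx muP.
have VW : (V <= Wh b h)%VS.
  apply: Wmax; split=> [g mu Gg /VP muP|mu /VP/stab_null muP]; last first.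
    exact: stab_fix (muP Lh).
  split; apply/VP=> y Ny; have [Jy _] := null_partP _ _ Ny.
    by rewrite lactE // muP // null_part_mulGr.
  by rewrite Defs.ractE // muP // null_part_mulGl.
rewrite -(ev_coord (i, j) Jx); apply: xP; apply: subvP VW _ _.
by apply/VP=> y /null_partP[Jy yP]; rewrite ev_coord // yP.
Qed.

Lemma Delta_JE (r : root) : (r \in Delta_J F b) = (b r.1 < b r.2)%N.
Proof. by rewrite inE delta_J. Qed.

Lemma delta_null h i j : (b i < b j)%N ->
  (delta_mx i j \in null_part h) = ~~ scalar_on b h (b i) (b j).
Proof.
move=> bij; apply/null_partP/idP => [[_ nP]|nsc].
  by apply/negP=> /nP/eqP; rewrite mxE !eqxx oner_eq0.
split; first by rewrite delta_J.
move=> r s; rewrite mxE; case: andP => // -[/eqP-> /eqP->] sc.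
by rewrite sc in nsc.
Qed.

Lemma Delta_hE h (r : root) : h \in L ->
  (r \in Delta_h b h) = (r \in Delta_J F b) && scalar_on b h (b r.1) (b r.2).
Proof.
move=> Lh; rewrite [r \in Delta_h b h]inE JhE //; have [Jr|//] := boolP (r \in _).
by rewrite delta_null ?negbK // -Delta_JE.
Qed.

Lemma HDP (D : {set root}) h : D \subset Delta_J F b ->
  reflect (h \in L /\ forall r, r \in D -> scalar_on b h (b r.1) (b r.2))
          (h \in HD F b D).
Proof.
move=> DJ; have HL : h \in HD F b D -> h \in L by case/stabP.
apply: (iffP idP) => [Hh | [Lh hP]]; last first.
  apply/(stab_null _ Lh)=> y /null_partP[Jy yP]; rewrite ev_lamD // big1 // => r Dr.
  by rewrite yP ?hP.
have Lh := HL Hh; split=> // r Dr; have := subsetP DJ r Dr; rewrite Delta_JE => br.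
apply: contraT; rewrite -delta_null // => /(stab_null _ Lh Hh).
rewrite ev_lamD ?delta_J // (bigD1 r) //= big1 => [|s /andP[_ nsr]].
  by rewrite mxE !eqxx addr0 => /eqP; rewrite oner_eq0.
rewrite mxE; case: andP => // -[/eqP e1 /eqP e2].
by rewrite -pair_eqE /pair_eq e1 e2 !eqxx in nsr.
Qed.

Lemma HD_sub_levi (D : {set root}) : HD F b D \subset L.
Proof. by apply/subsetP=> h /stabP[]. Qed.

(** This symmetry between h and D is the reason why the numbers of characters and
    of classes agree. *)
Lemma HD_Delta_h (D : {set root}) h : D \subset Delta_J F b -> h \in L ->
  (h \in HD F b D) = (D \subset Delta_h b h).
Proof.
move=> DJ Lh; apply/HDP/subsetP => // [[_ hP] r Dr|hP].
  by rewrite Delta_hE // (subsetP DJ) ?hP.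
by split=> // r /hP; rewrite Delta_hE // => /andP[].
Qed.

(** Replacing the blocks outside P by identity blocks is multiplicative on L, hence
    preserves invertibility; this is how k in L is split into two commuting
    factors below. *)
Definition keep_blocks (P : pred 'I_l) (A : M) : M :=
  \matrix_(i, j) if P (b i) then A i j else 1%:M i j.

Lemma keep_blocksM P (g k : GL) : g \in L -> k \in L ->
  keep_blocks P (mx (g * k)%g) = keep_blocks P (mx g) *m keep_blocks P (mx k).
Proof.
move=> /leviP gP /leviP kP; apply/matrixP=> i j; rewrite mxM !mxE.
case: ifP => [Pi|nPi].
  apply: eq_bigr => a _; rewrite !mxE Pi; case: ifP => // nPa.
  by rewrite gP ?mul0r //; apply: contraFneq nPa => <-.
rewrite (bigD1 i) //= big1 => [|a ai].
  by rewrite !mxE nPi eqxx mul1r addr0.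
by rewrite !mxE nPi eq_sym (negPf ai) mul0r.
Qed.

Lemma keep_blocks_levi P (k : GL) : k \in L ->
  exists2 k' : GL, k' \in L & mx k' = keep_blocks P (mx k).
Proof.
move=> Lk; have Lk' := groupVr Lk; have := keep_blocksM P Lk Lk'.
have -> : keep_blocks P (mx (k * k^-1)%g) = 1%:M.
  by rewrite mulgV mx1; apply/matrixP=> i j; rewrite mxE if_same.
move/esym/mulmx1_unit=> [uk _]; have [k' kE] := GL_of_unit uk; exists k' => //.
apply/leviP=> i j nb; rewrite kE !mxE; case: ifP => _; first by have /leviP-> := Lk.
by have [ij|//] := eqVneq i j; rewrite ij eqxx in nb.
Qed.

(** Each diagonal block of an element of H(D) is either arbitrary, when D does not
    reach it, or scalar.  Conjugation by k is not felt by the scalar blocks, so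
    k may be replaced by its part k' on the other blocks, which lies in H(D). *)
Lemma HD_conj (D : {set root}) k : D \subset Delta_J F b -> k \in L ->
  exists2 k', k' \in HD F b D & forall h, h \in HD F b D -> (h ^ k = h ^ k')%g.
Proof.
move=> DJ Lk.
pose P (t : 'I_l) := [forall r in D, ~~ (b r.1 <= t <= b r.2)%N].
have [k1 L1 k1E] := keep_blocks_levi P Lk.
have [k2 L2 k2E] := keep_blocks_levi (predC P) Lk.
have kE : k = (k2 * k1)%g.
  apply: mx_inj; rewrite mxM k2E k1E; apply/matrixP=> i j; rewrite mxE.
  have [Pi|nPi] := boolP (P (b i)).
    rewrite (bigD1 i) //= big1 => [|a ai]; first by rewrite !mxE /= Pi eqxx mul1r addr0.
    by rewrite !mxE /= Pi eq_sym (negPf ai) mul0r.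
  rewrite (bigD1 j) //= big1 => [|a aj].
    rewrite !mxE /= nPi eqxx addr0; case: ifP => [Pj|_]; last by rewrite mulr1.
    by have /leviP->  := Lk; rewrite ?mul0r //; apply: contraNneq nPi => ->.
  rewrite !mxE /= nPi; case: ifP => [Pa|_]; last by rewrite (negPf aj) mulr0.
  by have /leviP->  := Lk; rewrite ?mul0r //; apply: contraNneq nPi => ->.
exists k1 => [|h /(HDP _ DJ)[Lh hP]].
  apply/HDP=> //; split=> // r Dr; apply/scalar_onP; exists 1 => i j rij.
  rewrite k1E mxE; case: ifP => [/forall_inP/(_ r Dr)|_]; last by rewrite mxE.
  by rewrite rij.
rewrite kE conjgM; congr (_ ^ _)%g; apply/conjg_fixP/commgP.
have {}hP i j : ~~ P (b i) -> mx h i j = mx h i i *+ (i == j) /\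
    forall a, b a = b i -> mx h a j = mx h i i *+ (a == j).
  rewrite negb_forall_in => /exists_inP[r Dr]; rewrite negbK => rij.
  have /scalar_onP[c cP] := hP r Dr.
  have ci : mx h i i = c by rewrite cP // eqxx.
  by split=> [|a bai]; rewrite ci cP // bai.
apply: mx_inj; rewrite !mxM; apply/matrixP=> i j; rewrite !mxE.
have [Pi|nPi] := boolP (P (b i)).
  rewrite [RHS](bigD1 i) //= [X in _ = _ + X]big1 ?addr0 => [|a ai]; last first.
    by rewrite k2E !mxE /= Pi eq_sym (negPf ai) mul0r.
  rewrite (bigD1 j) //= big1 ?addr0 => [|a aj].
    rewrite k2E !mxE /= Pi /=.
    rewrite !eqxx mul1r; case: ifP => [nPj|_]; last by rewrite mulr1.
    by have /leviP->  := Lh; rewrite ?mul0r //; apply: contraNneq nPj => <-.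
  rewrite k2E !mxE /=; case: ifP => [nPa|_]; last by rewrite (negPf aj) mulr0.
  by have /leviP->  := Lh; rewrite ?mul0r //; apply: contraNneq nPa => <-.
rewrite (bigD1 i) //= big1 ?addr0 => [|a ai]; last first.
  by have [-> _] := hP i a nPi; rewrite eq_sym (negPf ai) mul0r.
rewrite (bigD1 j) //= big1 ?addr0 => [|a aj].
  have [bij|nb] := eqVneq (b i) (b j).
    by have [_ ->//] := hP i j nPi; rewrite eqxx mulrC.
  by have /leviP-> // := L2; rewrite mulr0 mul0r.
have [bia|nb] := eqVneq (b i) (b a).
  by have [_ ->//] := hP i j nPi; rewrite (negPf aj) mulr0.
by have /leviP-> // := L2; rewrite mul0r.
Qed.

Lemma HD_norm (D : {set root}) k h : D \subset Delta_J F b -> k \in L ->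
  (h ^ k \in HD F b D)%g = (h \in HD F b D).
Proof.
move=> DJ; suff sub k0 h0 : k0 \in L -> h0 \in HD F b D -> (h0 ^ k0)%g \in HD F b D.
  move=> Lk; apply/idP/idP => [|/sub]; last exact.
  by move/(sub k^-1%g); rewrite conjgK groupV => ->.
by move=> Lk Hh; have [k' Hk ->] := HD_conj DJ Lk; rewrite ?groupJ.
Qed.

End Explicit.

(** * Rook placements: ranks and normal forms *)

Section Rooks.

Variables (F : finFieldType) (n l : nat) (b : 'I_n.+1 -> 'I_l).

Local Notation M := 'M[F]_n.+1.
Local Notation GL := (GLn F n).
Local Notation root := ('I_n.+1 * 'I_n.+1)%type.
Local Notation J := (Jalg F b).
Local Notation G := (parabolic F b).
Local Notation L := (levi F b).
Local Notation xD := (@Defs.xD F n).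
Local Notation rook D := (D \in rooks setT).

Lemma rooksP (Delta D : {set root}) :
  reflect (D \subset Delta /\ forall r s, r \in D -> s \in D ->
             (r.1 == s.1) || (r.2 == s.2) -> r = s)
          (D \in rooks Delta).
Proof.
rewrite inE; apply: (iffP andP) => -[DD rD]; split=> //.
  by move=> r s Dr Ds rs; have /forall_inP/(_ r Dr)/forall_inP/(_ s Ds)/implyP/(_ rs)/eqP := rD.
apply/forall_inP=> r Dr; apply/forall_inP=> s Ds; apply/implyP=> rs.
by apply/eqP/rD.
Qed.

Lemma rooks_sub (Delta D D' : {set root}) (Delta' : {set root}) :
  D \in rooks Delta -> D' \subset D -> D' \subset Delta' -> D' \in rooks Delta'.
Proof.
move=> /rooksP[_ rD] sD sDelta; apply/rooksP; split=> // r s Dr Ds.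
by apply: rD; apply: (subsetP sD).
Qed.

Lemma rooksT (Delta D : {set root}) : D \in rooks Delta -> rook D.
Proof. by move=> rD; apply: rooks_sub rD _ _. Qed.

Lemma xDE D i j : xD D i j = ((i, j) \in D)%:R.
Proof.
rewrite summxE; have [Dij|nDij] := boolP ((i, j) \in D).
  rewrite (bigD1 (i, j)) //= big1 => [|r /andP[_ nr]]; first by rewrite mxE !eqxx addr0.
  rewrite mxE; case: andP => // -[/eqP ei /eqP ej].
  by rewrite -pair_eqE /pair_eq /= ei ej !eqxx in nr.
rewrite big1 // => r Dr; rewrite mxE; case: andP => // -[/eqP ei /eqP ej].
by rewrite ei ej -surjective_pairing Dr in nDij.
Qed.

Lemma xD_J D : (xD D \in J) = (D \subset Delta_J F b).
Proof.
apply/JalgP/subsetP => [DP [i j] Dij|DP i j].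
  rewrite Delta_JE /= ltnNge; apply/negP=> /DP/eqP.
  by rewrite xDE Dij oner_eq0.
rewrite xDE leqNgt; case: ((i, j) \in D) (DP (i, j)) => // /(_ isT).
by rewrite Delta_JE => /= ->.
Qed.

(** x_D factors through the space indexed by D, with a one-sided inverse on each
    side because D meets every row and every column at most once. *)
Lemma rook_rank D : rook D -> \rank (xD D) = #|D|.
Proof.
move=> /rooksP[_ rD].
pose A : 'M[F]_(#|D|, n.+1) := \matrix_(a, i) ((enum_val a).1 == i)%:R.
pose B : 'M[F]_(#|D|, n.+1) := \matrix_(a, i) ((enum_val a).2 == i)%:R.
have xAB : xD D = A^T *m B.
  apply/matrixP=> i j; rewrite summxE big_enum_val mxE; apply: eq_bigr => a _.
  by rewrite !mxE -natrM mulnb ![_ == i]eq_sym ![_ == j]eq_sym.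
have A1 : A *m A^T = 1%:M.
  apply/matrixP=> a c; rewrite !mxE (bigD1 (enum_val a).1) //= big1 => [|i /negPf ni].
    rewrite !mxE eqxx mul1r addr0; congr (nat_of_bool _)%:R; apply/eqP/eqP => [e|->//].
    by apply/enum_val_inj/rD; rewrite ?enum_valP // e eqxx.
  by rewrite !mxE eq_sym ni mul0r.
have B1 : B *m B^T = 1%:M.
  apply/matrixP=> a c; rewrite !mxE (bigD1 (enum_val a).2) //= big1 => [|i /negPf ni].
    rewrite !mxE eqxx mul1r addr0; congr (nat_of_bool _)%:R; apply/eqP/eqP => [e|->//].
    by apply/enum_val_inj/rD; rewrite ?enum_valP // e eqxx orbT.
  by rewrite !mxE eq_sym ni mul0r.
apply/eqP; rewrite eqn_leq; apply/andP; split.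
  by rewrite xAB (leq_trans (mxrankM_maxr _ _)) // rank_leq_row.
have e1 : A *m xD D *m B^T = 1%:M by rewrite xAB !mulmxA A1 mul1mx B1.
rewrite -[leqLHS](mxrank1 F) -e1 (leq_trans (mxrankM_maxl _ _)) //.
exact: mxrankM_maxr.
Qed.

Definition mask (R S : pred 'I_n.+1) (A : M) : M :=
  diag_mx (\row_i (R i)%:R) *m A *m diag_mx (\row_i (S i)%:R).

Lemma maskE R S A i j : mask R S A i j = if R i && S j then A i j else 0.
Proof.
rewrite /mask mul_mx_diag mxE mul_diag_mx !mxE.
by case: (R i); case: (S j); rewrite ?(mulr1, mul1r, mulr0, mul0r).
Qed.

Definition box_count (D : {set root}) (R S : pred 'I_n.+1) :=
  #|[set r in D | R r.1 && S r.2]|.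

Lemma box_count_rank D R S : rook D ->
  box_count D R S = \rank (mask R S (xD D)).
Proof.
move=> rD; rewrite /box_count -rook_rank; last first.
  by apply: rooks_sub rD _ _ => //; apply/subsetP=> r; rewrite inE => /andP[].
congr (\rank _); apply/matrixP=> i j; rewrite maskE !xDE inE /=.
by case: (R i && S j); rewrite ?andbT ?andbF.
Qed.

(** When A only mixes rows of R into R, and B columns of S into S, the corner R x S
    of A x_D B is a product involving only the corner R x S of x_D, so its rank,
    which is a number of rooks, cannot increase. *)
Lemma box_count_le (R S : pred (ordinal n.+1)) (A B : M) D D' : rook D -> rook D' ->
    (forall i a, R i -> ~~ R a -> A i a = 0) ->
    (forall c j, S j -> ~~ S c -> B c j = 0) ->
    (forall i j, R i -> S j -> xD D' i j = (A *m xD D *m B) i j) ->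
  (box_count D' R S <= box_count D R S)%N.
Proof.
move=> rD rD' AR BS DD'; rewrite !box_count_rank //.
set PR := diag_mx (\row_i (R i)%:R) : M; set PS := diag_mx (\row_i (S i)%:R) : M.
have PRA : PR *m A = PR *m A *m PR.
  apply/matrixP=> i j; rewrite mul_mx_diag mxE mul_diag_mx !mxE.
  have [Rj|nRj] := boolP (R j); first by rewrite mulr1.
  by have [Ri|_] := boolP (R i); [rewrite AR // !mulr0 | rewrite !mul0r].
have BPS : B *m PS = PS *m B *m PS.
  apply/matrixP=> i j; rewrite !mul_mx_diag mul_diag_mx !mxE.
  have [Sj|nSj] := boolP (S j); last by rewrite !mulr0.
  by have [Si|nSi] := boolP (S i); [rewrite mul1r | rewrite BS // !mulr0 mul0r].
have -> : mask R S (xD D') = PR *m A *m mask R S (xD D) *m (B *m PS).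
  transitivity (mask R S (A *m xD D *m B)).
    by apply/matrixP=> i j; rewrite !maskE; case: andP => // -[Ri Sj]; apply: DD'.
  rewrite /mask -/PR -/PS.
  transitivity (PR *m A *m PR *m xD D *m (PS *m B *m PS)); last by rewrite !mulmxA.
  by rewrite -PRA -BPS !mulmxA.
by rewrite (leq_trans (mxrankM_maxl _ _)) // mxrankM_maxr.
Qed.

(** R' and S' are R and S with one block of indices removed: the rooks in that
    pair of blocks are counted by inclusion-exclusion. *)
Lemma dnum_inclusion_exclusion (R R' S S' : pred 'I_n.+1) D k m :
    (forall i, R i = (b i == k) || R' i) -> (forall i, R' i -> b i != k) ->
    (forall j, S j = (b j == m) || S' j) -> (forall j, S' j -> b j != m) ->
  (dnum b D k m + box_count D R' S + box_count D R S' =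
   box_count D R S + box_count D R' S')%N.
Proof.
move=> RE nR' SE nS'; rewrite /dnum /box_count.
have cntE (P : pred root) : #|[set r in D | P r]| = (\sum_(r in D) P r)%N.
  by rewrite cardsE -sum1_card big_mkcondr /=; apply: eq_bigr => r _; case: (P r).
rewrite !cntE -!big_split /=; apply: eq_bigr => r _; rewrite RE SE.
have := nR' r.1; have := nS' r.2.
case: (b r.1 == k) => /=; case: (b r.2 == m) => /=;
case: (R' r.1) => //=; case: (S' r.2) => //=;
first [by move=> /(_ isT) | by move=> _ /(_ isT)].
Qed.

Lemma rook_equivP D D' :
  reflect (forall k m : 'I_l, (k < m)%N -> dnum b D k m = dnum b D' k m)
          (rook_equiv b D D').
Proof.
apply: (iffP forallP) => [dP k m km|dP k].
  by have /forallP/(_ m)/implyP/(_ km)/eqP := dP k.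
by apply/forallP=> m; apply/implyP=> km; rewrite dP.
Qed.

(** If h is scalar on the segment [k, m], the corner of rows from block k on and
    columns up to block m is not affected by J_h, so its rank is an invariant of
    the orbit modulo J_h.  If h is not scalar there, no rook of Delta_h lies in
    the pair of blocks (k, m). *)
Lemma rook_equiv_mod h D D' (g1 g2 : GL) : h \in L ->
    D \in rooks (Delta_h b h) -> D' \in rooks (Delta_h b h) ->
    g1 \in G -> g2 \in G ->
    xD D' - mx g1 *m xD D *m mx g2 \in null_part b h ->
  rook_equiv b D D'.
Proof.
move=> Lh.
pose R k (i : 'I_n.+1) := (k <= b i)%N; pose S m (j : 'I_n.+1) := (b j < m)%N.
have le k m E E' g g' : E \in rooks (Delta_h b h) -> E' \in rooks (Delta_h b h) ->
    g \in G -> g' \in G -> xD E' - mx g *m xD E *m mx g' \in null_part b h ->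
    (forall i j, R k i -> S m j -> scalar_on b h (b i) (b j)) ->
  (box_count E' (R k) (S m) <= box_count E (R k) (S m))%N.
  move=> /rooksT rE /rooksT rE' /parabolicP Gg /parabolicP Gg' /null_partP[_ nP] sc.
  apply: (box_count_le (A := mx g) (B := mx g')) rE rE' _ _ _ => [i a Ri nRa|c j Sj nSc|i j Ri Sj].
  - by rewrite Gg //; rewrite -ltnNge in nRa; apply: leq_trans Ri.
  - by rewrite Gg' //; rewrite -leqNgt in nSc; apply: leq_trans nSc.
  by apply/eqP; rewrite -subr_eq0; apply/eqP; have := nP i j (sc i j Ri Sj); rewrite !mxE.
move=> rD rD' G1 G2 DD'; have G1' := groupVr G1; have G2' := groupVr G2.
have D'D : xD D - mx g1^-1%g *m xD D' *m mx g2^-1%g \in null_part b h.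
  rewrite -[xD D - _]opprB -[xD D]mul1mx -[1%:M *m _]mulmx1.
  rewrite -{1}(mxVl g1) -(mxVr g2) -!mulmxA -mulmxBr !mulmxA -mulmxBl.
  have := null_part_mulGl (null_part_mulGr DD' G2') G1'; rewrite mulmxA.
  move=> /null_partP[Jy yP]; apply/null_partP; split=> [|i j /yP yij]; first by rewrite memvN.
  by rewrite mxE yij oppr0.
have [[sD _] [sD' _]] := (rooksP _ _ rD, rooksP _ _ rD').
apply/rook_equivP=> k m km; have [sc|nsc] := boolP (scalar_on b h k m); last first.
  have d0 (E : {set root}) : E \subset Delta_h b h -> dnum b E k m = 0%N.
    move=> sE; apply/eqP; rewrite cards_eq0 -subset0; apply/subsetP=> r.
    rewrite inE => /and3P[Er /eqP rk /eqP rm]; have := subsetP sE r Er.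
    by rewrite Delta_hE // rk rm (negPf nsc) andbF.
  by rewrite !d0.
have eq_box k' m' : (k <= k')%N -> (m' <= m.+1)%N ->
    box_count D (R k') (S m') = box_count D' (R k') (S m').
  move=> kk mm; have sc' i j : R k' i -> S m' j -> scalar_on b h (b i) (b j).
    move=> Ri Sj; apply: scalar_on_sub sc; first exact: leq_trans Ri.
    by rewrite -ltnS (leq_trans Sj).
  apply/eqP; rewrite eqn_leq (le k' m' D D' g1 g2) //.
  by rewrite (le k' m' D' D g1^-1%g g2^-1%g).
have H E : (dnum b E k m + box_count E (R k.+1) (S m.+1) + box_count E (R k) (S m) =
   box_count E (R k) (S m.+1) + box_count E (R k.+1) (S m))%N.
  apply: dnum_inclusion_exclusion => i; rewrite /R /S.
  - by rewrite leq_eqVlt eq_sym.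
  - by rewrite neq_ltn orbC => ->.
  - by rewrite ltnS leq_eqVlt.
  by rewrite neq_ltn => ->.
by have := H D; rewrite !eq_box // -H => /addIn/addIn.
Qed.

(** Through the matrix of values of a form on the matrix units of J, the pair
    (a, c) acts by multiplication with a^T and c^T, which are block lower triangular.
    The corners to use are therefore the opposite ones, rows up to block k and columns
    from block m on, with k < m so that they lie inside J. *)
Lemma lamD_orbit_equiv D D' (g1 g2 : GL) :
    D \in rooks (Delta_J F b) -> D' \in rooks (Delta_J F b) ->
    g1 \in G -> g2 \in G ->
    (forall x, x \in J ->
       ev (lamD F b D') x = ev (lamD F b D) (mx g1 *m x *m mx g2)) ->
  rook_equiv b D D'.
Proof.
pose R k (i : 'I_n.+1) := (b i < k)%N; pose S m (j : 'I_n.+1) := (m <= b j)%N.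
have le k m E E' g g' : E \in rooks (Delta_J F b) -> E' \in rooks (Delta_J F b) ->
    g \in G -> g' \in G ->
    (forall x, x \in J -> ev (lamD F b E') x = ev (lamD F b E) (mx g *m x *m mx g')) ->
    (forall i j, R k i -> S m j -> b i < b j)%N ->
  (box_count E' (R k) (S m) <= box_count E (R k) (S m))%N.
  move=> /rooksT rE /rooksT rE' Gg Gg' EE' RS.
  have [/parabolicP gP /parabolicP gP'] := (Gg, Gg').
  apply: (box_count_le (A := (mx g)^T) (B := (mx g')^T)) rE rE' _ _ _.
  - by move=> i a Ri nRa; rewrite mxE gP // (leq_trans Ri) // leqNgt.
  - by move=> c j Sj nSc; rewrite mxE gP' // (leq_trans _ Sj) // ltnNge.
  move=> i j Ri Sj; have Jij : delta_mx i j \in J by rewrite delta_J RS.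
  have := EE' _ Jij; rewrite !ev_lamD ?Jalg_bimul // => e.
  transitivity (\sum_(r in E') (delta_mx i j : M) r.1 r.2).
    rewrite summxE; apply: eq_bigr => r _.
    by rewrite !mxE ![_ == r.1]eq_sym ![_ == r.2]eq_sym.
  rewrite e mulmx_sumr mulmx_suml summxE; apply: eq_bigr => r _.
  by rewrite !mul_delta_mulE !mxE.
move=> rD rD' G1 G2 DD'; have G1' := groupVr G1; have G2' := groupVr G2.
have D'D x : x \in J ->
    ev (lamD F b D) x = ev (lamD F b D') (mx g1^-1%g *m x *m mx g2^-1%g).
  move=> Jx; rewrite DD' ?Jalg_bimul // !mulmxA mxVr mul1mx.
  by rewrite -mulmxA mxVl mulmx1.
apply/rook_equivP=> k m km.
have eq_box k' m' : (k' <= k.+1)%N -> (m <= m')%N ->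
    box_count D (R k') (S m') = box_count D' (R k') (S m').
  move=> kk mm; have RS i j : R k' i -> S m' j -> (b i < b j)%N.
    move=> Ri Sj; apply: leq_trans (leq_trans mm Sj).
    by apply: leq_trans km; rewrite ltnS -ltnS (leq_trans Ri).
  apply/eqP; rewrite eqn_leq (le k' m' D D' g1 g2) //.
  by rewrite (le k' m' D' D g1^-1%g g2^-1%g).
have H E : (dnum b E k m + box_count E (R k) (S m) + box_count E (R k.+1) (S m.+1) =
   box_count E (R k.+1) (S m) + box_count E (R k) (S m.+1))%N.
  apply: dnum_inclusion_exclusion => i; rewrite /R /S.
  - by rewrite ltnS leq_eqVlt.
  - by rewrite neq_ltn => ->.
  - by rewrite leq_eqVlt eq_sym.
  by rewrite neq_ltn orbC => ->.
by have := H D; rewrite !eq_box // -H => /addIn/addIn.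
Qed.

(** D and D' having equally many rooks in the pair of blocks of r, a rook of D only
    is balanced there by a rook of D' only. *)
Lemma dnum_partner D D' r : (forall k m : 'I_l, (k < m)%N -> dnum b D k m = dnum b D' k m) ->
    D \subset Delta_J F b -> r \in D :\: D' ->
  exists2 s, s \in D' :\: D & b s.1 = b r.1 /\ b s.2 = b r.2.
Proof.
move=> dDD' sD /setDP[Dr nD'r].
have br : (b r.1 < b r.2)%N by rewrite -(@Delta_JE F) (subsetP sD).
have := dDD' _ _ br; rewrite /dnum; set A := [set _ in D | _]; set A' := [set _ in D' | _].
move=> cA; have : ~~ (A' \subset A).
  apply: contraNN nD'r => sA; have eA : A' = A by apply/eqP; rewrite eqEcard sA cA leqnn.
  have : r \in A by rewrite inE Dr !eqxx.
  by rewrite -eA inE => /and3P[].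
case/subsetPn=> s; rewrite !inE => /and3P[Ds s1 s2]; rewrite s1 s2 !andbT => nDs.
by exists s; [rewrite inE Ds andbT | split; apply/eqP].
Qed.

Lemma tperm_block (i j a : 'I_n.+1) : b i = b j -> b (tperm i j a) = b a.
Proof. by move=> bij; case: tpermP => [->|->|]. Qed.

Lemma tperm_levi (i j : 'I_n.+1) : b i = b j ->
  exists2 p : GL, p \in L & mx p = perm_mx (tperm i j).
Proof.
move=> bij; have [p pE] := GL_of_unit (unitmx_perm F (tperm i j)); exists p => //.
apply/leviP=> r s nb; rewrite pE !mxE; case: eqP => // e.
by rewrite -e tperm_block ?eqxx in nb.
Qed.

(** Transpositions inside blocks move a rook r of D outside D' to a rook s of D'
    outside D.  The rooks common to D and D' share no row or column with r, as D
    is a placement, nor with s, as D' is one; so they stay in place and the number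
    of common rooks increases. *)
Lemma rook_equiv_conj D D' :
    D \in rooks (Delta_J F b) -> D' \in rooks (Delta_J F b) -> rook_equiv b D D' ->
  exists p q : GL, [/\ p \in L, q \in L & mx p *m xD D *m mx q = xD D'].
Proof.
move=> rD rD' /rook_equivP eDD'.
have [m] := ubnP #|D' :\: D|; elim: m D rD eDD' => // m IHm D rD eDD'; rewrite ltnS => leDm.
have [sD rkD] := rooksP _ _ rD; have [sD' rkD'] := rooksP _ _ rD'.
have [D'D0|[s D's]] := set_0Vmem (D' :\: D).
  have -> : D = D'.
    apply/eqP; rewrite eqEsubset; apply/andP; split; last by rewrite -setD_eq0 D'D0.
    apply/subsetP=> r Dr; apply: contraT => nD'r.
    have /(dnum_partner eDD' sD)[s] : r \in D :\: D' by rewrite inE nD'r.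
    by rewrite D'D0 inE.
  by exists 1%g, 1%g; rewrite !group1 mx1 mul1mx mulmx1.
have [r Dr [br1 br2]] := dnum_partner (fun k m km => esym (eDD' k m km)) sD' D's.
have [/setDP[D's' nDs] /setDP[Dr' nD'r]] := (D's, Dr).
have [p Lp pE] := tperm_levi br1; have [q Lq qE] := tperm_levi br2.
pose f (t : root) : root := (tperm r.1 s.1 t.1, tperm r.2 s.2 t.2).
have fK : involutive f by move=> [t1 t2]; rewrite /f /= !tpermK.
have fb t : b (f t).1 = b t.1 /\ b (f t).2 = b t.2 by rewrite !tperm_block.
pose D1 := f @^-1: D.
have xD1 : mx p *m xD D *m mx q = xD D1.
  rewrite pE qE -[tperm r.2 _]tpermV -row_permE -col_permE.
  by apply/matrixP=> i j; rewrite !mxE !xDE inE.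
have rD1 : D1 \in rooks (Delta_J F b).
  apply/rooksP; split=> [|t u].
    apply/subsetP=> t; rewrite inE => /(subsetP sD).
    by rewrite !Delta_JE !(fb t).1 !(fb t).2.
  rewrite !inE => Dt Du tu; apply: (inv_inj fK); apply: rkD => //=.
  by rewrite !(inj_eq perm_inj).
have dD1 k k' : dnum b D1 k k' = dnum b D k k'.
  rewrite /dnum -[in RHS](on_card_preimset (f := f)); last first.
    by apply: onW_bij; exact: inv_bij fK.
  by apply: eq_card => t; rewrite !inE !(fb t).1 !(fb t).2.
have [] := IHm D1 rD1.
- by move=> k k' kk'; rewrite dD1 eDD'.
- apply: leq_trans leDm; apply: proper_card; apply/properP; split.
    apply/subsetP=> t /setDP[D't nD1t]; rewrite inE D't andbT.
    apply: contra nD1t => Dt; rewrite inE.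
    suff -> : f t = t by [].
    have nr : (t.1 != r.1) && (t.2 != r.2).
      rewrite -negb_or; apply: contra nD'r => /(rkD _ _ Dt Dr') <- //.
    have ns : (t.1 != s.1) && (t.2 != s.2).
      rewrite -negb_or; apply: contra nDs => /(rkD' _ _ D't D's') <- //.
    case/andP: nr => n1 n2; case/andP: ns => n3 n4.
    by rewrite /f !tpermD 1?eq_sym // -surjective_pairing.
  by exists s => //; rewrite !inE /f tpermR tpermR -surjective_pairing Dr'.
move=> p' [q' [Lp' Lq' e]]; exists (p' * p)%g, (q * q')%g.
by rewrite !groupM // !mxM -e -xD1 !mulmxA.
Qed.

Hypothesis b_mono : forall i j : 'I_n.+1, (i <= j)%N -> (b i <= b j)%N.

Lemma upper_parabolic (A : M) :
    (forall i j : 'I_n.+1, (j < i)%N -> A i j = 0) -> (forall i, A i i != 0) ->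
  exists2 g : GL, g \in G & mx g = A.
Proof.
move=> A0 A1; have uA : A \in unitmx.
  rewrite -unitmx_tr unitmxE det_trig; last first.
    by apply/is_trig_mxP=> i j ij; rewrite mxE A0.
  by rewrite unitfE; apply/prodf_neq0 => i _; rewrite mxE.
have [g gE] := GL_of_unit uA; exists g => //; apply/parabolicP=> i j bji.
by rewrite gE A0 // ltnNge; apply: contraL bji => /b_mono; rewrite -leqNgt.
Qed.

(** Gaussian elimination, one rook at a time: x_D is the part already reduced and y
    lives in the remaining rows and columns.  Take the last nonzero row r of y and
    its first nonzero entry, in column c.  As y vanishes below r and, in row r, to
    the left of c, clearing column c and row r only uses upper triangular matrices. *)
Lemma rook_elimination m (y : M) D : rook D ->
    (forall i j r, r \in D -> i = r.1 \/ j = r.2 -> y i j = 0) ->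
    (#|[set i | row i y != 0%R]| <= m)%N ->
  exists (g1 g2 : GL) D', [/\ g1 \in G, g2 \in G, rook D' &
    mx g1 *m (y + xD D) *m mx g2 = xD D'].
Proof.
elim: m y D => [|m IHm] y D rD yD.
  rewrite leqn0 cards_eq0 => /eqP y0.
  have -> : y = 0.
    apply/row_matrixP=> i; rewrite row0; apply/eqP.
    by have /setP/(_ i) := y0; rewrite !inE => /negbFE.
  by exists 1%g, 1%g, D; rewrite !group1 mx1 mul1mx mulmx1 add0r.
have [->|y0] := eqVneq y 0.
  by exists 1%g, 1%g, D; rewrite !group1 mx1 mul1mx mulmx1 add0r.
have [r0 Pr0] : exists r, row r y != 0.
  apply/existsP; apply: contraNT y0; rewrite negb_exists => /forallP y0.
  by apply/eqP/row_matrixP=> i; rewrite row0; apply/eqP; have := y0 i; rewrite negbK.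
case: (@arg_maxnP _ r0 (fun r => row r y != 0) (fun r => r : nat) Pr0) => r yr0 rmax.
have [c0 Pc0] : exists c, y r c != 0.
  by case/rV0Pn: yr0 => c; rewrite mxE; exists c.
case: (@arg_minnP _ c0 (fun c => y r c != 0) (fun c => c : nat) Pc0) => c yrc cmin.
have u0 (i j : 'I_n.+1) : (r < i)%N -> y i j = 0.
  move=> ri; apply/eqP; apply: contraLR ri => yij; rewrite -leqNgt; apply: rmax.
  by apply/rV0Pn; exists j; rewrite mxE.
have v0 (j : 'I_n.+1) : (j < c)%N -> y r j = 0.
  by move=> jc; apply/eqP; apply: contraLR jc => yrj; rewrite -leqNgt; apply: cmin.
pose a := y r c.
have Dr j : xD D r j = 0.
  rewrite xDE; have [Drj|//] := boolP ((r, j) \in D).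
  by rewrite (yD r c _ Drj) ?eqxx // in yrc; left.
have Dc i : xD D i c = 0.
  rewrite xDE; have [Dic|//] := boolP ((i, c) \in D).
  by rewrite (yD r c _ Dic) ?eqxx // in yrc; right.
(* g1 scales row r by 1 / a and clears column c; g2 then clears row r. *)
have [g1 G1 g1E] : exists2 g : GL, g \in G &
    mx g = \matrix_(i, j) ((i == j)%:R - a^-1 * (y i c - (i == r)%:R) * (j == r)%:R).
  apply: upper_parabolic => [i j ji|i]; rewrite !mxE.
    have -> : (i == j) = false by apply: contraTF ji => /eqP->; rewrite ltnn.
    have [jr|_] := eqVneq j r; last by rewrite mulr0 subr0.
    rewrite jr in ji; rewrite u0 // (_ : (i == r) = false) ?subr0 ?mulr0 ?mul0r ?subr0 //.
    by apply: contraTF ji => /eqP->; rewrite ltnn.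
  have [->|_] := eqVneq i r; last by rewrite mulr0 subr0 eqxx oner_eq0.
  by rewrite eqxx mulr1 mulrBr mulVf // mulr1 opprB addrC subrK invr_eq0.
have [g2 G2 g2E] : exists2 g : GL, g \in G &
    mx g = \matrix_(i, j) ((i == j)%:R - (i == c)%:R * (a^-1 * y r j - (j == c)%:R)).
  apply: upper_parabolic => [i j ji|i]; rewrite !mxE.
    have -> : (i == j) = false by apply: contraTF ji => /eqP->; rewrite ltnn.
    have [ic|_] := eqVneq i c; last by rewrite mul0r subr0.
    rewrite ic in ji; rewrite v0 // (_ : (j == c) = false) ?subr0 ?mulr0 ?subr0 //.
    by apply: contraTF ji => /eqP->; rewrite ltnn.
  have [->|_] := eqVneq i c; last by rewrite mul0r subr0 eqxx oner_eq0.
  by rewrite eqxx mulVf // subrr mulr0 subr0 oner_eq0.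
(* The result is y minus the rank one matrix that agrees with y on row r and on
   column c. *)
pose y' : M := \matrix_(i, j) (y i j - a^-1 * y i c * y r j).
have Drc : (r, c) \notin D by have := Dr c; rewrite xDE; case: (_ \in D) => // /eqP; rewrite oner_eq0.
have step : mx g1 *m (y + xD D) *m mx g2 = y' + xD ((r, c) |: D).
  have e1 i j : (mx g1 *m (y + xD D)) i j =
      y i j + xD D i j - a^-1 * (y i c - (i == r)%:R) * y r j.
    rewrite g1E mxE (eq_bigr (fun k => (i == k)%:R * (y k j + xD D k j) -
      a^-1 * (y i c - (i == r)%:R) * ((k == r)%:R * (y k j + xD D k j)))); last first.
      by move=> k _; rewrite !mxE; ring.
    rewrite big_split /= (bigD1 i) //= big1 => [|k /negPf ki]; last by rewrite eq_sym ki mul0r.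
    rewrite sumrN -mulr_sumr (bigD1 r) //= big1 => [|k /negPf kr]; last by rewrite kr mul0r.
    by rewrite !eqxx Dr !addr0 !mul1r.
  apply/matrixP=> i j; rewrite g2E mxE (eq_bigr (fun k => (k == j)%:R * (mx g1 *m (y + xD D)) i k -
      (a^-1 * y r j - (j == c)%:R) * ((k == c)%:R * (mx g1 *m (y + xD D)) i k))); last first.
    by move=> k _; rewrite [X in _ * X = _]mxE; ring.
  rewrite big_split /= (bigD1 j) //= big1 => [|k /negPf kj]; last by rewrite kj mul0r.
  rewrite sumrN -mulr_sumr (bigD1 c) //= big1 => [|k /negPf kc]; last by rewrite kc mul0r.
  rewrite !eqxx !addr0 !mul1r !e1 Dc addr0 [RHS]mxE [y' i j]mxE.
  have -> : xD ((r, c) |: D) i j = xD D i j + (i == r)%:R * (j == c)%:R.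
    rewrite !xDE !inE xpair_eqE; case: andP => [[/eqP-> /eqP->]|nij] /=.
      by rewrite (negPf Drc) !eqxx mulr1 add0r.
    by rewrite -natrM mulnb; case: andP nij => //; rewrite addr0.
  have : a^-1 * y r c = 1 by rewrite mulVf.
  move: (y r c) (a^-1) => t s st.
  have -> : y i c - s * (y i c - (i == r)%:R) * t = (i == r)%:R.
    by rewrite -mulrA mulrC -mulrA [t * _]mulrC st mulr1 opprB addrC subrK.
  by ring.
have rD' : rook ((r, c) |: D).
  have [_ rkD] := rooksP _ _ rD; apply/rooksP; split=> // t t'.
  have nrc t1 : t1 \in D -> ~~ ((r == t1.1) || (c == t1.2)).
    move=> Dt; apply/negP=> /orP[] /eqP e; case/eqP: yrc; apply: (yD _ _ t1) => //; by [left|right].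
  rewrite !inE => /orP[/eqP->|Dt] /orP[/eqP->|Dt'] //=.
  - by rewrite (negPf (nrc _ Dt')).
  - by rewrite ![t.1 == _]eq_sym ![t.2 == _]eq_sym (negPf (nrc _ Dt)).
  exact: rkD.
move=> lem; have [] := IHm y' _ rD'.
- move=> i j t; rewrite inE => /orP[/set1P-> /= [->|->]|Dt ij].
  + by rewrite mxE mulVf // mul1r subrr.
  + by rewrite mxE mulrAC mulVf // mul1r subrr.
  rewrite mxE (yD i j t) // sub0r; case: ij => [it|jt].
    by rewrite (yD i c t) ?mulr0 ?mul0r ?oppr0 //; left.
  by rewrite (yD r j t) ?mulr0 ?oppr0 //; right.
- rewrite -ltnS; apply: leq_trans lem; apply: proper_card; apply/properP; split.
    apply/subsetP=> i; rewrite !inE; apply: contra => /eqP/rowP yi.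
    apply/eqP/rowP=> j; have yi0 k : y i k = 0 by have := yi k; rewrite !mxE.
    by rewrite !mxE !yi0 mulr0 mul0r subr0.
  exists r; rewrite inE // negbK; apply/eqP/rowP=> j.
  by rewrite !mxE mulVf // mul1r subrr.
move=> h1 [h2 [D' [H1 H2 rkD' e]]]; exists (h1 * g1)%g, (g2 * h2)%g, D'.
by rewrite !groupM // !mxM -e -step !mulmxA.
Qed.

Lemma rook_normal_form (y : M) : exists (g1 g2 : GL) D,
  [/\ g1 \in G, g2 \in G, rook D & mx g1 *m y *m mx g2 = xD D].
Proof.
have rook0 : rook (set0 : {set root}).
  by apply/rooksP; split=> [|r s]; rewrite ?sub0set ?inE.
have y0 i j r : r \in (set0 : {set root}) -> i = r.1 \/ j = r.2 -> y i j = 0.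
  by rewrite inE.
have [g1 [g2 [D [G1 G2 rD e]]]] := rook_elimination rook0 y0 (leqnn _).
exists g1, g2, D; split=> //; rewrite -e; congr (_ *m _ *m _).
by apply/matrixP=> i j; rewrite mxE xDE inE addr0.
Qed.

End Rooks.

(** * Additive characters of F *)

Section AdditiveCharacter.

Variables (F : finFieldType) (e : additive_character F).

Lemma addcharN t : e (- t) = (e t)^-1.
Proof.
apply: (mulfI (addchar_neq0 e t)).
by rewrite -addcharD subrr addchar0 mulfV ?addchar_neq0.
Qed.

(** The values of e are roots of unity, since F has positive characteristic. *)
Lemma addchar_conj t : (e t)^* = e (- t).
Proof.
have [p p_pr pF] := finPcharP F.
have eM m : e (t *+ m) = e t ^+ m.
  elim: m => [|m IHm]; first by rewrite mulr0n addchar0.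
  by rewrite mulrS addcharD IHm exprS.
have norm1 : `|e t| = 1.
  apply/eqP; rewrite -(@pexpr_eq1 _ _ p) ?prime_gt0 // -normrX -eM.
  by rewrite (mulrn_pchar pF) addchar0 normr1.
by rewrite addcharN invC_norm norm1 expr1n invr1 mul1r.
Qed.

(** f takes every value, so e o f is nontrivial on the group J, and translating by
    an element where it is not 1 shows that the sum vanishes. *)
Lemma addchar_sum0 n l (b : 'I_n.+1 -> 'I_l) (f : 'M[F]_n.+1 -> F) :
    (exists t, e t <> 1) ->
    {in Jalg F b &, forall x y, f (x + y) = f x + f y} ->
    (forall c, {in Jalg F b, forall x, f (c *: x) = c * f x}) ->
    (exists2 x, x \in Jalg F b & f x != 0) ->
  \sum_(x in Jalg F b) e (f x) = 0.
Proof.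
move=> [t et] fD fZ [x0 Jx0 fx0]; pose x1 := (t / f x0) *: x0.
have Jx1 : x1 \in Jalg F b by rewrite memvZ.
have fx1 : f x1 = t by rewrite fZ // mulfVK.
have : (e t - 1) * \sum_(x in Jalg F b) e (f x) = 0.
  rewrite mulrBl mul1r mulr_sumr; apply/eqP; rewrite subr_eq0; apply/eqP.
  rewrite [RHS](reindex_inj (addrI x1)) /=; apply: eq_big => [x|x Jx].
    by rewrite rpredDl.
  by rewrite fD // addcharD fx1.
by move/eqP; rewrite mulf_eq0 subr_eq0 => /orP[/eqP|/eqP].
Qed.

End AdditiveCharacter.

(** * The induced characters *)

Section Characters.

Variables (F : finFieldType) (n l : nat) (b : 'I_n.+1 -> 'I_l).
Hypothesis b_mono : forall i j : 'I_n.+1, (i <= j)%N -> (b i <= b j)%N.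
Variable e : additive_character F.
Hypothesis e_nontrivial : exists t : F, e t <> 1.

Local Notation M := 'M[F]_n.+1.
Local Notation GL := (GLn F n).
Local Notation root := ('I_n.+1 * 'I_n.+1)%type.
Local Notation J := (Jalg F b).
Local Notation G := (parabolic F b).
Local Notation L := (levi F b).
Local Notation U := (unip F b).
Local Notation Jdual := 'Hom(subvs_of J, F^o).

Variable lam : Jdual.

Lemma Jright_mulGr z g : g \in G -> (z *m mx g \in Jright lam) = (z \in Jright lam).
Proof.
suff sub z0 g0 : g0 \in G -> z0 \in Jright lam -> z0 *m mx g0 \in Jright lam.
  move=> Gg; apply/idP/idP; last exact: sub.
  by move/(sub _ _ (groupVr Gg)); rewrite -mulmxA mxVr mulmx1.
move=> Gg /JrightP[Jz zP]; apply/JrightP; split=> [|x Jx]; first exact: Jalg_mulGr.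
by rewrite -mulmxA zP // Jalg_mulGl.
Qed.

Lemma ev_Jright_unip z u : z \in Jright lam -> u \in U -> ev lam (z *m mx u) = ev lam z.
Proof.
move=> /JrightP[Jz zP] /unipP Ju.
by rewrite -[mx u](subrK 1) mulmxDr mulmx1 evD zP // add0r.
Qed.

(** Split c = p u with u in 1 + J: the sum over u is that of the additive character
    x |-> e (lam (z p x)) of J, which is trivial exactly when z p, or equivalently
    z, lies in J_right. *)
Lemma sum_right_orbit z : z \in J ->
  \sum_(c in G) e (ev lam (z *m mx c)) =
  if z \in Jright lam then #|U|%:R * \sum_(p in L) e (ev lam (z *m mx p)) else 0.
Proof.
move=> Jz; rewrite (sum_parabolic b); have [Rz|nRz] := boolP (z \in _).
  rewrite mulr_sumr; apply: eq_bigr => p Lp.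
  rewrite mulr_natl -sumr_const; apply: eq_bigr => u Uu.
  by rewrite mxM mulmxA ev_Jright_unip // Jright_mulGr ?(levi_parabolic Lp).
rewrite big1 // => p Lp; have Gp := levi_parabolic Lp.
have Jzp := Jalg_mulGr Jz Gp.
transitivity (e (ev lam (z *m mx p)) * \sum_(x in J) e (ev lam (z *m mx p *m x))).
  rewrite -(sum_unip b_mono (fun x => e (ev lam (z *m mx p *m x)))) mulr_sumr.
  apply: eq_bigr => u Uu; rewrite -addcharD -evD -[X in X + _]mulmx1 -mulmxDr.
  by rewrite addrC subrK mxM mulmxA.
rewrite (addchar_sum0 (e := e)) ?mulr0 //.
- by move=> x y Jx Jy; rewrite mulmxDr evD.
- by move=> c x Jx; rewrite -scalemxAr evZ.
apply/exists_inP; apply: contraNT nRz; rewrite negb_exists_in => /forall_inP zP.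
rewrite -(Jright_mulGr z Gp); apply/JrightP; split=> // x Jx.
by have := zP x Jx; rewrite negbK => /eqP.
Qed.

Definition orbit_sum (x : M) : algC :=
  \sum_(a in G) \sum_(c in G) e (ev lam (mx a *m x *m mx c)).

Hypothesis lam_levi : forall k, k \in L -> exists2 k', k' \in stab lam &
  forall h, h \in stab lam -> (h ^ k = h ^ k')%g.

Lemma stab_levi h : h \in stab lam -> h \in L.
Proof. by case/stabP. Qed.

Lemma stab_conj h k : k \in L -> ((h ^ k)%g \in stab lam) = (h \in stab lam).
Proof.
suff sub k0 h0 : k0 \in L -> h0 \in stab lam -> (h0 ^ k0)%g \in stab lam.
  move=> Lk; apply/idP/idP => [|/sub]; last exact.
  by move/(sub k^-1%g); rewrite conjgK groupV => ->.
by move=> Lk Hh; have [k' Hk ->] := lam_levi Lk; rewrite ?groupJ.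
Qed.

Lemma null_part_mulJr h x y : x \in null_part b h -> y \in J -> x *m y \in null_part b h.
Proof.
move=> /null_partP[Jx xP] Jy; apply/null_partP; split; first exact: Jalg_mul.
move=> i j sij; rewrite mxE big1 // => k _.
have [bjk|bkj] := leqP (b j) (b k); first by have /JalgP-> := Jy; rewrite ?mulr0.
by rewrite xP ?mul0r //; apply: scalar_on_sub sij; rewrite // ltnW.
Qed.

(** With y = k w, the unipotent part u1 of (h u)^y is (w^-1)^(h^k) w u^y.  Its first
    two factors form a commutator of h^k with U, and such commutators are 1 modulo
    [null_part] because h^k acts trivially on the quotient of J by it. *)
Lemma conjg_levi_unip h u y : h \in L -> u \in U -> y \in G ->
  exists k w u1 : GL, [/\ k \in L, w \in U & y = (k * w)%g] /\
    [/\ u1 \in U, ((h * u) ^ y = (h ^ k) * u1)%g &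
        mx u1 - mx (u ^ y)%g \in null_part b (h ^ k)%g].
Proof.
move=> Lh Uu Gy; have [k [w [Lk Uw ->]]] := parabolicLU Gy.
have Lhk : (h ^ k)%g \in L by rewrite groupJ.
have Ghk := levi_parabolic Lhk; have Gk := levi_parabolic Lk.
have Uw' := groupVr Uw; have Gw := unip_parabolic Uw.
pose z := ((w^-1) ^ (h ^ k) * w)%g.
have Uuy : (u ^ (k * w))%g \in U by rewrite unip_norm ?groupM.
have Uz : z \in U by rewrite groupM ?unip_norm.
exists k, w, (z * u ^ (k * w))%g; split; split=> //; first by rewrite groupM.
  by rewrite conjMg !conjgM /z [((h ^ k) ^ w)%g]conjgE [(w^-1 ^ _)%g]conjgE !mulgA mulgV mul1g.
have -> : mx (z * u ^ (k * w))%g - mx (u ^ (k * w))%g = (mx z - 1) *m mx (u ^ (k * w))%g.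
  by rewrite mxM mulmxBl mul1mx.
apply: null_part_mulGr; last exact: unip_parabolic.
have -> : mx z - 1 = (mx (w^-1 ^ (h ^ k))%g - mx w^-1%g) *m mx w.
  by rewrite mulmxBl mxVl -mxM.
apply: null_part_mulGr => //.
have -> : mx (w^-1 ^ (h ^ k))%g - mx w^-1%g =
    mx (h ^ k)^-1%g *m (mx w^-1%g - 1) *m mx (h ^ k)%g - (mx w^-1%g - 1).
  by rewrite -mx_conj1 opprB addrA subrK.
have /unipP Jw := Uw'; have Jhw := Jalg_mulGl Jw (groupVr Ghk).
by have := commutator_null_part Lhk Jhw; rewrite !mulmxA mxVr mul1mx.
Qed.

Lemma U0_unip u : u \in U0 lam -> u \in U.
Proof. by move=> /U0P/JrightP[Ju _]; apply/unipP. Qed.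

Lemma sum_subg_levi (f : GL -> algC) :
  \sum_(p : subg_of (levi_group F b)) f (sgval p) = \sum_(p in L) f p.
Proof.
rewrite [RHS](reindex (fun p : subg_of (levi_group F b) => sgval p)) /=; last first.
  exists (subg (levi_group F b)) => [p _|p Lp]; first exact: sgvalK.
  exact: subgK.
by apply: eq_bigl => p; rewrite subgP.
Qed.

(** One term of the induction formula.  By [conjg_levi_unip] the summand sees only
    y^-1 (u - 1) y; multiplying by y on the right affects neither membership in
    J_right nor, after summing over p, the values, so y may be dropped on that
    side and [sum_right_orbit] applies to z = y^-1 (u - 1). *)
Lemma sum_xi_conj (theta : 'CF(stab_group lam)) h u y :
    h \in L -> u \in U -> y \in G ->
  \sum_p xi e theta p ((h * u) ^ y)%g =
  if h \in stab lam then
    theta h * (#|U|%:R^-1 * \sum_(c in G) e (ev lam (mx y^-1%g *m (mx u - 1) *m mx c)))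
  else 0.
Proof.
move=> Lh Uu Gy; have [k [w [u1 [[Lk Uw yE] [U1 hyE Nu1]]]]] := conjg_levi_unip Lh Uu Gy.
have Lhk : (h ^ k)%g \in L by rewrite groupJ.
have Gk := levi_parabolic Lk; have /unipP Ju := Uu.
have [Hh|nHh] := boolP (h \in stab lam); last first.
  rewrite big1 // => p _; rewrite cfun0 //.
  apply: contra nHh; rewrite hyE => /mulsgP[k1 v1 Hk1 Uv1 eq1].
  have [eh _] := LU_inj Lhk U1 (stab_levi Hk1) (U0_unip Uv1) eq1.
  by rewrite -(stab_conj h Lk) eh.
have Hhk : (h ^ k)%g \in stab lam by rewrite stab_conj.
have null0 := stab_null lam Lhk Hhk.
have thetaE : theta (h ^ k)%g = theta h.
  by have [k' Hk' ->] := lam_levi Lk; rewrite // cfunJ.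
set z := mx y^-1%g *m (mx u - 1).
have Jz : z \in J by rewrite Jalg_mulGl ?groupV.
have uyE : mx (u ^ y)%g - 1 = z *m mx y by rewrite mx_conj1.
have u1E : mx u1 - 1 = (mx u1 - mx (u ^ y)%g) + z *m mx y.
  by rewrite -uyE addrA subrK.
have U0E : (u1 \in U0 lam) = (z \in Jright lam).
  rewrite -(Jright_mulGr z Gy); apply/U0P/idP => /JrightP[J1 P1]; apply/JrightP; split.
  - exact: Jalg_mulGr.
  - move=> x Jx; have := P1 x Jx; rewrite u1E mulmxDl evD null0 ?add0r //.
    exact: null_part_mulJr.
  - by rewrite (unipP _ _ U1).
  move=> x Jx; rewrite u1E mulmxDl evD P1 // null0 ?addr0 //.
  exact: null_part_mulJr.
rewrite sum_right_orbit //.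
have [Rz|nRz] := boolP (z \in Jright lam); last first.
  rewrite !mulr0 big1 // => p _; rewrite cfun0 // hyE.
  apply: contra nRz => /mulsgP[k1 v1 Hk1 Uv1 eq1].
  have [_ eu] := LU_inj Lhk U1 (stab_levi Hk1) (U0_unip Uv1) eq1.
  by rewrite -U0E eu.
rewrite mulKf ?neq0CG // -(sum_subg_levi (fun p => e (ev lam (z *m mx p)))) mulr_sumr.
(* y = k w, and w is absorbed by ev_Jright_unip once moved to the right of p; the
   factor k is absorbed by reindexing the sum over p. *)
pose kL := subg (levi_group F b) k.
rewrite [RHS](reindex_inj (mulgI kL)); apply: eq_bigr => p _.
rewrite hyE xiE ?U0E // thetaE; congr (_ * e _).
have Lp := subgP p; have Gp := levi_parabolic Lp.
have J1 : mx u1 - 1 \in J by apply/unipP.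
rewrite lactE // u1E mulmxDl evD null0 ?null_part_mulGr // add0r.
have -> : sgval (kL * p)%g = (k * sgval p)%g by rewrite sgvalM // subgK.
rewrite yE mxM.
have -> : z *m (mx k *m mx w) *m mx (sgval p) =
    z *m mx (k * sgval p)%g *m mx (w ^ sgval p)%g.
  by rewrite -!mulmxA -!mxM [(w ^ _)%g]conjgE mulKVg.
have Gkp : (k * sgval p)%g \in G by rewrite groupM.
by rewrite ev_Jright_unip ?unip_norm ?Jright_mulGr.
Qed.

Lemma induced_xiE (theta : 'CF(stab_group lam)) h u : h \in L -> u \in U ->
  'Ind[parabolic_group F b, G0_group lam] (\sum_p xi e theta p) (h * u)%g =
  if h \in stab lam then
    theta h * ((#|G0 lam| * #|U|)%:R^-1 * orbit_sum (mx u - 1)) else 0.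
Proof.
move=> Lh Uu; rewrite cfIndE ?G0_sub //.
rewrite (eq_bigr (fun y => if h \in stab lam then
    theta h * (#|U|%:R^-1 * \sum_(c in G) e (ev lam (mx y^-1%g *m (mx u - 1) *m mx c)))
  else 0)); last by move=> y Gy; rewrite sum_cfunE sum_xi_conj.
case: ifP => _; last by rewrite big1_eq mulr0.
rewrite -mulr_sumr -mulr_sumr natrM invfM mulrCA !mulrA; congr (_ * _).
rewrite /orbit_sum (reindex_inj invg_inj); apply: eq_big => [y|y _]; first by rewrite groupV.
by rewrite invgK.
Qed.

Lemma orbit_sumG x g1 g2 : g1 \in G -> g2 \in G ->
  orbit_sum (mx g1 *m x *m mx g2) = orbit_sum x.
Proof.
move=> G1 G2; rewrite /orbit_sum (reindex_inj (mulIg g1^-1%g)); apply: eq_big => [a|a _].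
  by rewrite groupMr ?groupV.
rewrite (reindex_inj (mulgI g2^-1%g)); apply: eq_big => [c|c _].
  by rewrite groupMl ?groupV.
by rewrite !mxM !mulmxA -[mx a *m _ *m _]mulmxA mxVl mulmx1 -[_ *m mx g2 *m _]mulmxA mxVr mulmx1.
Qed.

Lemma orbit_sum_null h x y : h \in stab lam -> x - y \in null_part b h ->
  orbit_sum x = orbit_sum y.
Proof.
move=> Hh Nxy; apply: eq_bigr => a Ga; apply: eq_bigr => c Gc; congr (e _).
have Lh := stab_levi Hh; apply/eqP; rewrite -subr_eq0 -evB -mulmxBl -mulmxBr.
by rewrite (stab_null lam Lh Hh) // null_part_mulGr ?null_part_mulGl.
Qed.

Lemma orbit_sum0 : orbit_sum 0 = (#|G| * #|G|)%:R.
Proof.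
rewrite /orbit_sum (eq_bigr (fun=> #|G|%:R)) => [|a _].
  by rewrite sumr_const natrM mulr_natr.
by rewrite -sumr_const; apply: eq_bigr => c _; rewrite mulmx0 mul0mx ev0 addchar0.
Qed.

(** xi is afforded by twisting the representation of theta, inflated to G_0, with
    the linear character u |-> e ((p lam) (u - 1)) of U_0, which is multiplicative
    and invariant under the stabilizer. *)
Lemma xi_char (i : Iirr (stab_group lam)) p : xi e 'chi_i p \is a character.
Proof.
pose A := stab lam; pose B := U0 lam; pose plam := lact (sgval p) lam.
pose r (g : GL) := e (ev plam (mx (remgr A B g) - 1)) *: 'Chi_i (divgr A B g).
have rE h u : h \in A -> u \in B -> r (h * u)%g = e (ev plam (mx u - 1)) *: 'Chi_i h.
  by move=> Ah Bu; rewrite /r divgrMid ?remgrMid ?stabI_U0.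
have r_repr : mx_repr (G0_group lam) r.
  split=> [|_ _ /mulsgP[h u Ah Bu ->] /mulsgP[k v Ak Bv ->]].
    by rewrite -[1%g]mulg1 rE ?group1 // repr_mx1 mx1 subrr ev0 addchar0 scale1r.
  have Buk : (u ^ k)%g \in B by rewrite memJ_norm // (subsetP (stab_norm_U0 lam)).
  have -> : (h * u * (k * v) = (h * k) * (u ^ k * v))%g.
    by rewrite !mulgA mulgK.
  rewrite (rE _ _ (groupM Ah Ak) (groupM Buk Bv)) (rE _ _ Ah Bu) (rE _ _ Ak Bv).
  have -> : 'Chi_i (h * k)%g = 'Chi_i h *m 'Chi_i k by apply: repr_mxM.
  rewrite /plam plam_U0 // plam_conj // addcharD.
  by rewrite -scalemxAl -scalemxAr scalerA.
suff -> : xi e 'chi_i p = cfRepr (MxRepresentation r_repr) by exact: cfRepr_char.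
apply/cfun_inP=> _ /mulsgP[h u Ah Bu ->]; rewrite xiE // !cfunE mem_mulg //=.
by rewrite rE // mxtraceZ -irrRepr cfunE Ah !mulr1n mulrC.
Qed.

End Characters.

(** * Orthogonality of the characters *)

Section Supercharacters.

Variables (F : finFieldType) (n l : nat) (b : 'I_n.+1 -> 'I_l).
Hypothesis b_mono : forall i j : 'I_n.+1, (i <= j)%N -> (b i <= b j)%N.
Variable e : additive_character F.
Hypothesis e_nontrivial : exists t : F, e t <> 1.

Local Notation M := 'M[F]_n.+1.
Local Notation GL := (GLn F n).
Local Notation root := ('I_n.+1 * 'I_n.+1)%type.
Local Notation J := (Jalg F b).
Local Notation G := (parabolic F b).
Local Notation L := (levi F b).
Local Notation U := (unip F b).
Implicit Types (D : {set root}) (h g u v : GL).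
Local Notation orbit_sumD D := (orbit_sum e (lamD F b D)).

Definition chi_scale (D : {set root}) : algC :=
  (#|G0 (lamD F b D)| * #|U|)%:R^-1.

Lemma chi_scale_neq0 D : chi_scale D != 0.
Proof.
by rewrite invr_eq0 natrM mulf_neq0 ?neq0CG.
Qed.

(** Outside H(D) the class function theta is 0, so no case distinction is left. *)
Lemma chiE (D : {set root}) (i : Iirr (HD F b D)) (h u : GL) :
    D \subset Delta_J F b -> h \in L -> u \in U ->
  chi e D i (h * u)%g = 'chi_i h * (chi_scale D * orbit_sumD D (mx u - 1)).
Proof.
move=> DJ Lh Uu; rewrite (induced_xiE b_mono e_nontrivial (fun k Lk => HD_conj DJ Lk)) //.
by case: ifPn => // nHh; rewrite cfun0 ?mul0r.
Qed.

Lemma chi_character (D : {set root}) (i : Iirr (HD F b D)) : chi e D i \is a character.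
Proof. by apply/cfInd_char/rpred_sum => p _; apply: xi_char. Qed.

Lemma chi_neq0 (D : {set root}) (i : Iirr (HD F b D)) :
  D \subset Delta_J F b -> chi e D i != 0.
Proof.
move=> DJ; apply: contraTneq (irr1_neq0 i) => chi0; rewrite negbK.
have := chiE i DJ (group1 _) (group1 (unip_group F b)).
rewrite mulg1 chi0 cfunE mx1 subrr orbit_sum0 => /esym/eqP.
rewrite natrM !mulf_eq0 (negPf (chi_scale_neq0 D)) !(negPf (neq0CG _)) !orbF.
by move/eqP->; rewrite eqxx.
Qed.

(** Each character being a function of h times a function of x, inner products are
    products of a sum over L and a sum over J. *)
Lemma cfdot_chiE (D D' : {set root}) (i : Iirr (HD F b D)) (i' : Iirr (HD F b D')) :
    D \subset Delta_J F b -> D' \subset Delta_J F b ->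
  '[chi e D i, chi e D' i'] = #|G|%:R^-1 *
     ((\sum_(h in L) 'chi_i h * ('chi_i' h)^*) *
      (chi_scale D * (chi_scale D')^* *
       \sum_(x in J) orbit_sumD D x * (orbit_sumD D' x)^*)).
Proof.
move=> DJ DJ'; rewrite cfdotE; congr (_ * _).
rewrite (sum_parabolic b) mulr_suml; apply: eq_bigr => h Lh.
rewrite -(sum_unip b_mono (fun x => orbit_sumD D x * (orbit_sumD D' x)^*)).
rewrite !mulr_sumr; apply: eq_bigr => u Uu.
by rewrite !chiE // !rmorphM /=; ring.
Qed.

Lemma cfdot_chi_irr (D : {set root}) (i i' : Iirr (HD F b D)) :
  D \subset Delta_J F b -> i != i' -> '[chi e D i, chi e D i'] = 0.
Proof.
move=> DJ ii'; rewrite cfdot_chiE //.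
rewrite (big_setID (HD F b D)) /= (setIidPr (HD_sub_levi F b D)).
rewrite [X in _ + X]big1 ?addr0 => [|h /setDP[_ nHh]]; last by rewrite cfun0 ?mul0r.
have := cfdot_irr i i'; rewrite (negPf ii') cfdotE => /eqP.
rewrite mulf_eq0 invr_eq0 (negPf (neq0CG _)) /= => /eqP ->.
by rewrite mul0r mulr0.
Qed.

Lemma lamD_same_orbit (D D' : {set root}) (a a' c c' : GL) :
    D \in rooks (Delta_J F b) -> D' \in rooks (Delta_J F b) ->
    a \in G -> a' \in G -> c \in G -> c' \in G ->
    (forall x, x \in J -> ev (lamD F b D) (mx a *m x *m mx c) =
       ev (lamD F b D') (mx a' *m x *m mx c')) ->
  rook_equiv b D D'.
Proof.
move=> rD rD' Ga Ga' Gc Gc' eqD; have [Va' Vc'] := (groupVr Ga', groupVr Gc').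
apply: (lamD_orbit_equiv (g1 := (a * a'^-1)%g) (g2 := (c'^-1 * c)%g)) rD rD' _ _ _.
- exact: groupM Ga Va'.
- exact: groupM Vc' Gc.
move=> x Jx; have Jx' := Jalg_bimul Va' Vc' Jx.
have xE : mx a' *m (mx a'^-1%g *m x *m mx c'^-1%g) *m mx c' = x.
  by rewrite !mulmxA mxVr mul1mx -mulmxA mxVl mulmx1.
have := eqD _ Jx'; rewrite xE => <-.
by rewrite !mxM !mulmxA.
Qed.

(** Expanded, this is a sum over a, a', c, c' of sums over J of e of a linear form,
    which is nonzero for orbits of lam_D and lam_D' that are distinct. *)
Lemma orbit_sum_orthogonal (D D' : {set root}) :
    D \in rooks (Delta_J F b) -> D' \in rooks (Delta_J F b) ->
    ~~ rook_equiv b D D' ->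
  \sum_(x in J) orbit_sumD D x * (orbit_sumD D' x)^* = 0.
Proof.
move=> rD rD' nDD'.
rewrite (eq_bigr (fun x => \sum_(a in G) \sum_(a' in G) \sum_(c in G) \sum_(c' in G)
    e (ev (lamD F b D) (mx a *m x *m mx c) - ev (lamD F b D') (mx a' *m x *m mx c')))).
  rewrite exchange_big big1 //= => a Ga; rewrite exchange_big big1 //= => a' Ga'.
  rewrite exchange_big big1 //= => c Gc; rewrite exchange_big big1 //= => c' Gc'.
  apply: addchar_sum0 => //.
  - move=> x y Jx Jy; rewrite !mulmxDr !mulmxDl !evD.
    by rewrite opprD addrACA.
  - by move=> k x Jx; rewrite -!scalemxAr -!scalemxAl !evZ mulrBr.
  apply/exists_inP; apply: contraNT nDD'; rewrite negb_exists_in => /forall_inP eqD.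
  apply: (lamD_same_orbit rD rD' Ga Ga' Gc Gc') => x Jx.
  by have := eqD _ Jx; rewrite negbK subr_eq0 => /eqP.
move=> x Jx; rewrite /orbit_sum rmorph_sum big_distrl /=; apply: eq_bigr => a Ga.
rewrite big_distrr /=; apply: eq_bigr => a' Ga'.
rewrite rmorph_sum big_distrl /=; apply: eq_bigr => c Gc.
rewrite big_distrr /=; apply: eq_bigr => c' Gc'.
by rewrite addcharD addchar_conj.
Qed.

(** * Representatives of rook classes and of conjugacy classes *)

Lemma rook_equiv_sym : symmetric (rook_equiv b).
Proof.
by move=> D D'; apply/rook_equivP/rook_equivP => eDD' k m km; rewrite eDD'.
Qed.

Lemma rook_equiv_refl D : rook_equiv b D D.
Proof. exact/rook_equivP. Qed.

Lemma rook_equiv_trans : transitive (rook_equiv b).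
Proof.
move=> D2 D1 D3 /rook_equivP e12 /rook_equivP e23; apply/rook_equivP => k m km.
by rewrite e12 ?e23.
Qed.

Lemma rook_repsP (Delta : {set root}) R : rook_representatives b Delta R ->
  [/\ {subset R <= rooks Delta},
      forall D, D \in rooks Delta -> exists2 D', D' \in R & rook_equiv b D D'
    & {in R &, forall D D', rook_equiv b D D' -> D = D'}].
Proof.
case/and3P=> _ /subsetP sR /forall_inP cardR.
have cl D : D \in rooks Delta ->
    exists D', R :&: [set y in rooks Delta | rook_equiv b D y] = [set D'].
  by move=> rD; apply/cards1P/cardR/imset_f.
split=> // [D rD|D D' RD RD' eDD'].
  have [D' eD'] := cl D rD; exists D'; have := set11 D'; rewrite -eD' in_setI in_set.
    by case/andP.
  by case/and3P.
have [D1 eD1] := cl D (sR D RD).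
have : D \in [set D1] by rewrite -eD1 in_setI RD in_set (sR _ RD) rook_equiv_refl.
have : D' \in [set D1] by rewrite -eD1 in_setI RD' in_set (sR _ RD').
by rewrite !in_set1 => /eqP-> /eqP->.
Qed.

Lemma class_repsP (C : {set GL}) : is_transversal C (classes L) L ->
  [/\ {subset C <= L},
      forall g, g \in L -> exists2 h, h \in C & g \in h ^: L
    & {in C &, forall h h', h' \in h ^: L -> h = h'}].
Proof.
case/and3P=> _ /subsetP sC /forall_inP cardC.
have cl g : g \in L -> exists h, C :&: g ^: L = [set h].
  by move=> Lg; apply/cards1P/cardC/mem_classes.
split=> // [g Lg|h h' Ch Ch' hh'].
  have [h eh] := cl g Lg; exists h; have := set11 h; rewrite -eh inE => /andP[] //.
  by rewrite class_sym.
have [h1 eh1] := cl h (sC h Ch).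
have : h \in [set h1] by rewrite -eh1 inE Ch class_refl.
have : h' \in [set h1] by rewrite -eh1 inE Ch'.
by rewrite !inE => /eqP-> /eqP->.
Qed.

(** * The sets K and the counting argument *)

Lemma pi_hP h x y : h \in L -> x \in J -> y \in J ->
  reflect (pi_h b h x = pi_h b h y) (x - y \in null_part b h).
Proof.
move=> Lh Jx Jy; rewrite -(JhE Lh); apply: (iffP idP) => [|exy]; last first.
  have : x \in pi_h b h y by rewrite -exy inE Jx subrr JhE ?null_part0.
  by rewrite inE => /andP[].
rewrite JhE // => Nxy; apply/setP=> z.
rewrite [z \in pi_h b h x]inE [z \in pi_h b h y]inE JhE //; congr (_ && _).
have Nyx : y - x \in null_part b h by rewrite -opprB -sub0r null_partB ?null_part0.
apply/idP/idP => Nz.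
  by have := null_partB Nz Nyx; rewrite opprB addrA subrK.
by have := null_partB Nz Nxy; rewrite opprB addrA subrK.
Qed.

Lemma KclassP h (D : {set root}) g : h \in L -> D \subset Delta_J F b ->
  reflect (exists h1 u g1 g2, [/\ h1 \in h ^: L, u \in U, g1 \in G /\ g2 \in G,
     mx u - 1 - mx g1 *m xD F D *m mx g2 \in null_part b h & g = (h1 * u)%g])
  (g \in Kclass b h D).
Proof.
move=> Lh DJ; have Jx g1 g2 : g1 \in G -> g2 \in G -> mx g1 *m xD F D *m mx g2 \in J.
  by move=> G1 G2; rewrite Jalg_bimul ?xD_J.
apply: (iffP mulsgP) => [[h1 u hh1 ux ->]|[h1 [u [g1 [g2 [hh1 Uu [G1 G2] N ->]]]]]].
  have [Ju] : mx u - 1 \in J /\ pi_h b h (mx u - 1) \in omega b h D.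
    by move: ux; rewrite /one_plus 2!in_set => /andP[].
  case/imset2P=> g1 g2 G1 G2 /(pi_hP Lh Ju (Jx _ _ G1 G2)) N.
  by exists h1, u, g1, g2; split=> //; apply/unipP.
exists h1 u => //; have /unipP Ju := Uu; rewrite /one_plus 2!in_set Ju /=.
by apply/imset2P; exists g1 g2; rewrite //; apply/pi_hP => //; apply: Jx.
Qed.


Lemma Delta_h_sub (h : GL) : Delta_h b h \subset Delta_J F b.
Proof. by apply/subsetP=> r; rewrite inE => /andP[]. Qed.

Lemma rooks_subset (Delta Delta' D : {set root}) : Delta \subset Delta' ->
  D \in rooks Delta -> D \in rooks Delta'.
Proof.
move=> sD rD; have [DD _] := rooksP _ _ rD.
by apply: rooks_sub rD _ _ => //; apply: subset_trans DD sD.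
Qed.

(** The Levi part of g determines h, and its unipotent part determines the orbit
    modulo J_h, hence the class of D. *)
Lemma Kclass_eq h h' D D' g (C : {set GL}) : is_transversal C (classes L) L ->
    h \in C -> h' \in C -> D \in rooks (Delta_h b h) -> D' \in rooks (Delta_h b h') ->
    g \in Kclass b h D -> g \in Kclass b h' D' ->
  h = h' /\ rook_equiv b D D'.
Proof.
move=> /class_repsP[sC _ injC] Ch Ch' rD rD'.
have [[sD _] [sD' _]] := (rooksP _ _ rD, rooksP _ _ rD').
have [Lh Lh'] := (sC _ Ch, sC _ Ch').
case/(KclassP _ Lh (subset_trans sD (Delta_h_sub _))) => h1 [u [g1 [g2 [hh1 Uu [G1 G2] N1 ->]]]].
case/(KclassP _ Lh' (subset_trans sD' (Delta_h_sub _))) => h2 [v [g3 [g4 [hh2 Uv [G3 G4] N2 eq_g]]]].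
have Lcl k k' : k \in L -> k' \in k ^: L -> k' \in L.
  by move=> Lk /imsetP[c Lc ->]; rewrite groupJ.
have [e1 e2] := LU_inj (Lcl _ _ Lh hh1) Uu (Lcl _ _ Lh' hh2) Uv eq_g.
have hh' : h = h'.
  have eh1 : h1 ^: L = h ^: L by apply/class_eqP.
  have eh2 : h1 ^: L = h' ^: L by rewrite e1; apply/class_eqP.
  by apply: injC => //; rewrite -eh1 eh2; apply: class_refl.
split=> //; subst h' u; have [V3 V4] := (groupVr G3, groupVr G4).
apply: (rook_equiv_mod (h := h) (g1 := (g3^-1 * g1)%g) (g2 := (g2 * g4^-1)%g)) => //.
- exact: groupM V3 G1.
- exact: groupM G2 V4.
have xE : mx g3^-1%g *m (mx g3 *m xD F D' *m mx g4) *m mx g4^-1%g = xD F D'.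
  by rewrite !mulmxA mxVl mul1mx -mulmxA mxVr mulmx1.
have := null_part_mulGr (null_part_mulGl (null_partB N1 N2) V3) V4.
rewrite opprB [_ - _ + _]addrC addrA subrK mulmxBr mulmxBl xE.
by rewrite !mxM !mulmxA.
Qed.

(** Being contained in Delta_h depends only on which pairs of blocks are occupied. *)
Lemma rook_equiv_Delta_h h D D' : h \in L -> D \subset Delta_J F b ->
  rook_equiv b D D' -> D' \subset Delta_h b h -> D \subset Delta_h b h.
Proof.
move=> Lh sD /rook_equivP eDD' sD'; apply/subsetP=> r Dr.
have Jr := subsetP sD r Dr; have br := Jr; rewrite Delta_JE in br.
have : (0 < dnum b D (b r.1) (b r.2))%N.
  by apply/card_gt0P; exists r; rewrite inE Dr !eqxx.
rewrite (eDD' _ _ br) => /card_gt0P[s]; rewrite inE => /and3P[Ds /eqP s1 /eqP s2].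
have := subsetP sD' s Ds; rewrite !Delta_hE // s1 s2 => /andP[_ ->].
by rewrite Jr.
Qed.

(** Comparing two systems of representatives that come from different sets of rook
    placements: neither is a transversal for the set of the other, but each maps
    into the other up to equivalence. *)
Lemma equiv_card_le (T : finType) (E : rel T) (A B : {set T}) :
    symmetric E -> transitive E ->
    (forall x, x \in A -> exists2 y, y \in B & E x y) ->
    {in A &, forall x y, E x y -> x = y} ->
  (#|A| <= #|B|)%N.
Proof.
move=> Es Et AB injA; pose f x := odflt x [pick y in B | E x y].
have fP x : x \in A -> f x \in B /\ E x (f x).
  move=> Ax; rewrite /f; case: pickP => [y /andP[] //|nB].
  by have [y By Exy] := AB x Ax; have := nB y; rewrite /= By Exy.
rewrite -(card_in_imset (f := f) (D := A)) => [|x y Ax Ay efxy].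
  by apply/subset_leq_card/subsetP=> _ /imsetP[x /fP[Bfx _] ->].
apply: injA => //; have [_ Ex] := fP x Ax; have [_ Ey] := fP y Ay.
by apply: Et Ex _; rewrite efxy Es.
Qed.

(** The representatives D with h in H(D) are those contained in Delta_h, and they
    represent the same classes as Rh does. *)
Lemma card_reps_Delta_h h RJ Rh : h \in L ->
    rook_representatives b (Delta_J F b) RJ ->
    rook_representatives b (Delta_h b h) Rh ->
  #|[set D in RJ | h \in HD F b D]| = #|Rh|.
Proof.
move=> Lh /rook_repsP[sRJ exRJ injRJ] /rook_repsP[sRh exRh injRh].
have hHD D : D \in RJ -> (h \in HD F b D) = (D \subset Delta_h b h).
  by move/sRJ/rooksP=> [sD _]; rewrite HD_Delta_h.
apply/eqP; rewrite eqn_leq; apply/andP; split.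
  apply: (equiv_card_le rook_equiv_sym rook_equiv_trans) => [D|D D'].
    rewrite inE => /andP[RD]; rewrite hHD // => sD; apply: exRh.
    by apply: rooks_sub (sRJ _ RD) _ sD.
  by rewrite !in_set => /andP[RD _] /andP[RD' _]; apply: injRJ.
apply: (equiv_card_le rook_equiv_sym rook_equiv_trans) injRh => D RD.
have rD := rooks_subset (Delta_h_sub h) (sRh _ RD).
have [D' RD' eDD'] := exRJ D rD; exists D' => //; rewrite inE RD' hHD //.
have [sD' _] := rooksP _ _ (sRJ _ RD').
apply: rook_equiv_Delta_h Lh sD' _ _; first by rewrite rook_equiv_sym; exact: eDD'.
by have [] := rooksP _ _ (sRh _ RD).
Qed.

(** By [HD_conj] two elements of H(D) conjugate in L are conjugate in H(D). *)
Lemma card_classes_HD (C : {set GL}) (D : {set root}) :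
    is_transversal C (classes L) L -> D \subset Delta_J F b ->
  #|classes (HD F b D)| = #|[set h in C | h \in HD F b D]|.
Proof.
move=> /class_repsP[sC exC injC] sD.
have clE h : h \in HD F b D -> h ^: HD F b D = h ^: L.
  move=> Hh; apply/setP=> g; apply/imsetP/imsetP => -[k Hk ->].
    by exists k; rewrite // (subsetP (HD_sub_levi F b D)).
  by have [k' Hk' hk] := HD_conj sD Hk; exists k'; rewrite // hk.
have Hcl h g : g \in HD F b D -> g \in h ^: L -> h \in HD F b D.
  by move=> Hg /imsetP[k Lk eg]; rewrite eg HD_norm in Hg.
have -> : classes (HD F b D) = (fun h => h ^: L) @: [set h in C | h \in HD F b D].
  apply/setP=> X; apply/imsetP/imsetP => [[g Hg ->]|[h]].
    have Lg := subsetP (HD_sub_levi F b D) g Hg.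
    have [h Ch hg] := exC g Lg; have Hh := Hcl h g Hg hg.
    by exists h; [rewrite inE Ch | rewrite clE //; apply/class_eqP].
  by rewrite inE => /andP[_ Hh] ->; exists h; rewrite // clE.
rewrite card_in_imset // => h h'; rewrite !inE => /andP[Ch _] /andP[Ch' _] ehh'.
by apply: injC; rewrite // ehh'; apply: class_refl.
Qed.

End Supercharacters.

(** * The supercharacter theory *)

Section Theory.

Variables (F : finFieldType) (n l : nat) (b : 'I_n.+1 -> 'I_l).
Hypothesis b_mono : forall i j : 'I_n.+1, (i <= j)%N -> (b i <= b j)%N.
Variable e : additive_character F.
Hypothesis e_nontrivial : exists t : F, e t <> 1.
Local Notation M := 'M[F]_n.+1.
Local Notation GL := (GLn F n).
Local Notation root := ('I_n.+1 * 'I_n.+1)%type.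
Local Notation J := (Jalg F b).
Local Notation G := (parabolic F b).
Local Notation L := (levi F b).
Local Notation U := (unip F b).
Implicit Types (D : {set root}) (h g u v : GL).

Lemma chi_const_Kclass D (i : Iirr (HD F b D)) h D' : D \subset Delta_J F b ->
    h \in L -> D' \subset Delta_J F b ->
  {in Kclass b h D' &, forall x y, chi e D i x = chi e D i y}.
Proof.
move=> sD Lh sD'.
suff val g : g \in Kclass b h D' ->
    chi e D i g = 'chi_i h * (chi_scale F b D * orbit_sum e (lamD F b D) (xD F D')).
  by move=> x y Kx Ky; rewrite !val.
case/(KclassP _ Lh sD') => h1 [u [g1 [g2 [/imsetP[k Lk ->] Uu [G1 G2] N ->]]]].
have [k' Hk' hk] := HD_conj sD Lk.
rewrite (chiE b_mono) ?groupJ //; have [Hh|nHh] := boolP (h \in HD F b D).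
  rewrite hk // cfunJ //; congr (_ * (_ * _)).
  by rewrite (orbit_sum_null e Hh N) orbit_sumG.
by rewrite !cfun0 ?mul0r // HD_norm.
Qed.

Lemma Kclass_sub h D : h \in L -> D \subset Delta_J F b -> Kclass b h D \subset G.
Proof.
move=> Lh sD; apply/subsetP=> g /(KclassP _ Lh sD)[h1 [u [g1 [g2 [/imsetP[k Lk ->] Uu _ _ ->]]]]].
by rewrite LU_parabolic ?groupJ.
Qed.

Lemma Kclass_neq0 h D : h \in L -> D \subset Delta_J F b ->
  exists g, g \in Kclass b h D.
Proof.
move=> Lh sD; have JxD : xD F D \in J by rewrite xD_J.
have [u Uu uE] := unip_surj b_mono JxD; exists (h * u)%g.
apply/(KclassP _ Lh sD); exists h, u, 1%g, 1%g; split; rewrite ?class_refl ?group1 //.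
by rewrite uE mx1 mul1mx mulmx1 [1 + _]addrC addrK subrr null_part0.
Qed.

(** Reduce the unipotent part of g to some x_D, discard the rooks outside Delta_h,
    whose matrix units lie in J_h, and move the rest to its representative by
    L x L. *)
Lemma Kclass_cover (C : {set GL}) (Rh : GL -> {set {set root}}) g :
    is_transversal C (classes L) L ->
    (forall h, h \in C -> rook_representatives b (Delta_h b h) (Rh h)) ->
    g \in G ->
  exists h D, [/\ h \in C, D \in Rh h & g \in Kclass b h D].
Proof.
move=> /class_repsP[sC exC _] Rh_repr Gg.
have [h1 [u [Lh1 Uu ->]]] := parabolicLU Gg.
have [h Ch hh1] := exC h1 Lh1; have Lh := sC h Ch.
have /rook_repsP[sR exR _] := Rh_repr h Ch.
have [g1 [g2 [D [G1 G2 rD gE]]]] := rook_normal_form b_mono (mx u - 1).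
have /unipP Ju := Uu.
have sD : D \subset Delta_J F b by rewrite -xD_J -gE Jalg_bimul.
pose D1 := D :&: Delta_h b h.
have rD1 : D1 \in rooks (Delta_h b h).
  by apply: rooks_sub rD _ _; rewrite ?subsetIl ?subsetIr.
have [D2 RD2 eD12] := exR D1 rD1; exists h, D2; split=> //.
have rJ D0 : D0 \in rooks (Delta_h b h) -> D0 \in rooks (Delta_J F b).
  exact: rooks_subset (Delta_h_sub _ _).
have rD2 := sR _ RD2; have [sD2 _] := rooksP _ _ (rJ _ rD2).
have eD21 : rook_equiv b D2 D1 by rewrite rook_equiv_sym.
have [p [q [Lp Lq pq]]] := rook_equiv_conj (rJ _ rD2) (rJ _ rD1) eD21.
have [V1 V2] := (groupVr G1, groupVr G2).
have [Gp Gq] := (levi_parabolic Lp, levi_parabolic Lq).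
apply/(KclassP _ Lh sD2); exists h1, u, (g1^-1 * p)%g, (q * g2^-1)%g; split=> //.
  by split; [apply: groupM V1 Gp | apply: groupM Gq V2].
have uE : mx u - 1 = mx g1^-1%g *m xD F D *m mx g2^-1%g.
  by rewrite -gE !mulmxA mxVl mul1mx -mulmxA mxVr mulmx1.
have -> : mx (g1^-1 * p)%g *m xD F D2 *m mx (q * g2^-1)%g =
    mx g1^-1%g *m xD F D1 *m mx g2^-1%g by rewrite -pq !mxM !mulmxA.
rewrite uE -mulmxBl -mulmxBr null_part_mulGr ?null_part_mulGl //.
apply/null_partP; split=> [|i j sij].
  by rewrite memvB ?xD_J // subIset ?sD.
rewrite mxE [X in _ + X]mxE !xDE inE; case Dij: ((i, j) \in D); last by rewrite subrr.
by rewrite Delta_hE // (subsetP sD) //= sij subrr.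
Qed.

(** For h = 1 every segment is scalar, so J_h = 0 and the orbit of 0 is reduced to
    0. *)
Lemma one_Kclass (C : {set GL}) (Rh : GL -> {set {set root}}) :
    is_transversal C (classes L) L ->
    (forall h, h \in C -> rook_representatives b (Delta_h b h) (Rh h)) ->
  exists h D, [/\ h \in C, D \in Rh h & Kclass b h D = [set 1%g]].
Proof.
move=> /[dup] trC /class_repsP[sC exC _] Rh_repr.
have [h [D [Ch RD K1]]] := Kclass_cover trC Rh_repr (group1 (parabolic_group F b)).
exists h, D; split=> //.
have Lh := sC h Ch; have /rook_repsP[sR _ _] := Rh_repr h Ch.
have [sD _] := rooksP _ _ (rooks_subset (Delta_h_sub _ _) (sR _ RD)).
apply/eqP; rewrite eq_sym eqEsubset sub1set K1 /=.
have := K1.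
case/(KclassP _ Lh sD) => h1 [u [g1 [g2 [hh1 Uu [G1 G2] N e1]]]].
have Lh1 : h1 \in L by case/imsetP: hh1 => k Lk ->; rewrite groupJ.
have [] := @LU_inj F n l b 1%g 1%g h1 u (group1 _) (group1 (unip_group F b)) Lh1 Uu.
  by rewrite -e1 mulg1.
move=> eh eu; subst h1 u.
have h1 : h = 1%g.
  by have [k Lk /esym/eqP] := imsetP hh1; rewrite conjg_eq1 => /eqP.
have null0 x : x \in null_part b h -> x = 0.
  move=> /null_partP[Jx xP]; apply/matrixP=> i j; rewrite mxE xP //.
  by apply/scalar_onP; exists 1 => r s _; rewrite h1 mx1 mxE.
have gxg0 : mx g1 *m xD F D *m mx g2 = 0.
  by have := null0 _ N; rewrite mx1 subrr sub0r => /eqP; rewrite oppr_eq0 => /eqP.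
have xD0 : xD F D = 0.
  transitivity (mx g1^-1%g *m (mx g1 *m xD F D *m mx g2) *m mx g2^-1%g).
    by rewrite !mulmxA mxVl mul1mx -mulmxA mxVr mulmx1.
  by rewrite gxg0 mulmx0 mul0mx.
apply/subsetP=> g /(KclassP _ Lh sD)[h2 [v [g3 [g4 [hh2 Uv _ N2 ->]]]]].
have -> : h2 = 1%g by case/imsetP: hh2 => k _ ->; rewrite h1 conj1g.
have /eqP := null0 _ N2; rewrite xD0 mulmx0 mul0mx subr0 subr_eq0 => /eqP v1.
by rewrite inE mul1g; apply/eqP/mx_inj.
Qed.

End Theory.

Theorem theorem3p6 (F : finFieldType) (n l : nat) (b : 'I_n.+1 -> 'I_l)
    (b_mono : forall i j : 'I_n.+1, (i <= j)%N -> (b i <= b j)%N)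
    (b_surj : forall k : 'I_l, exists i : 'I_n.+1, b i = k)
    (e : additive_character F) (e_nontrivial : exists t : F, e t <> 1%R)
    (RJ : {set {set 'I_n.+1 * 'I_n.+1}})
    (RJ_repr : rook_representatives b (Delta_J F b) RJ)
    (C : {set GLn F n})
    (C_repr : is_transversal C (classes (levi F b)) (levi F b))
    (Rh : GLn F n -> {set {set 'I_n.+1 * 'I_n.+1}})
    (Rh_repr : forall h, h \in C ->
       rook_representatives b (Delta_h b h) (Rh h)) :
  supercharacter_theory
    [seq chi e D i | D <- enum RJ, i <- enum (Iirr (HD F b D))]
    [seq Kclass b h D | h <- enum C, D <- enum (Rh h)].
Proof.
have [sRJ _ injRJ] := rook_repsP RJ_repr.
have sJ D : D \in RJ -> D \subset Delta_J F b by move/sRJ/rooksP=> [].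
have [sC _ _] := class_repsP C_repr.
have sRh h D : h \in C -> D \in Rh h -> D \in rooks (Delta_h b h).
  by move=> Ch; have [sR _ _] := rook_repsP (Rh_repr h Ch); apply: sR.
have sRhJ h D : h \in C -> D \in Rh h -> D \subset Delta_J F b.
  by move=> Ch /(sRh h D Ch)/rooksP[sD _]; apply: subset_trans sD (Delta_h_sub _ _).
set S := [seq chi e D i | D <- _, i <- _]; set K := [seq Kclass b h D | h <- _, D <- _].
have SP phi : phi \in S -> exists D (i : Iirr (HD F b D)), D \in RJ /\ phi = chi e D i.
  by case/allpairsPdep=> D [i [RD _ ->]]; exists D, i; rewrite mem_enum in RD.
have KP X : X \in K -> exists h D, [/\ h \in C, D \in Rh h & X = Kclass b h D].
  by case/allpairsPdep=> h [D []]; rewrite !mem_enum => Ch RD ->; exists h, D.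
have KI h D : h \in C -> D \in Rh h -> Kclass b h D \in K.
  by move=> Ch RD; apply/allpairsPdep; exists h, D; rewrite !mem_enum.
have K_inter h D h' D' g : h \in C -> D \in Rh h -> h' \in C -> D' \in Rh h' ->
    g \in Kclass b h D -> g \in Kclass b h' D' -> h = h' /\ D = D'.
  move=> Ch RD Ch' RD' Kg Kg'.
  have [hh' eDD'] := Kclass_eq C_repr Ch Ch' (sRh _ _ Ch RD) (sRh _ _ Ch' RD') Kg Kg'.
  split=> //; subst h'; have [_ _ injR] := rook_repsP (Rh_repr h Ch).
  exact: injR.
have S_orth D D' (i : Iirr (HD F b D)) (i' : Iirr (HD F b D')) :
    D \in RJ -> D' \in RJ -> D != D' -> '[chi e D i, chi e D' i'] = 0.
  move=> RD RD' nDD'; rewrite (cfdot_chiE b_mono e_nontrivial) ?sJ //.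
  rewrite orbit_sum_orthogonal ?mulr0 ?sRJ //.
  by apply: contraNN nDD' => eDD'; apply/eqP/injRJ.
split.
- rewrite /S /K !size_allpairs_dep !sumnE !big_map !big_enum /=.
  (* Both sizes are the number of pairs (h, D) with h in H(D). *)
  transitivity (\sum_(D in RJ) \sum_(h in C) (h \in HD F b D))%N.
    apply: eq_bigr => D RD; rewrite -cardE card_ord NirrE (card_classes_HD C_repr) ?sJ //.
    rewrite cardsE -sum1_card big_mkcondr /=.
    by apply: eq_bigr => h _; case: (h \in _).
  rewrite exchange_big /=; apply: eq_bigr => h Ch.
  rewrite -cardE -(card_reps_Delta_h (sC h Ch) RJ_repr (Rh_repr h Ch)).
  rewrite cardsE -sum1_card big_mkcondr /=.
  by apply: eq_bigr => D _; case: (h \in _).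
- split; first by move=> _ /SP[D [i [_ ->]]]; apply: chi_character.
  apply/pairwise_orthogonalP; split; last first.
    move=> _ _ /SP[D [i [RD ->]]] /SP[D' [i' [RD' ->]]].
    have [eDD' nchi|nDD' _] := eqVneq D D'; last exact: S_orth.
    subst D'; apply: cfdot_chi_irr; rewrite ?sJ //.
    by apply: contraNneq nchi => ->.
  rewrite /= -/S; apply/andP; split.
    apply/negP=> /SP[D [i [RD /esym/eqP]]]; apply/negP.
    by apply: chi_neq0 => //; apply: sJ.
  apply: allpairs_uniq_dep => [|D _|]; rewrite ?enum_uniq //.
  move=> _ _ /allpairsPdep[D [i [RD _ ->]]] /allpairsPdep[D' [i' [RD' _ ->]]] /= echi.
  rewrite !mem_enum in RD RD'.
  have nchi : '[chi e D i, chi e D' i'] != 0.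
    by rewrite -echi cfnorm_eq0 chi_neq0 ?sJ.
  have eDD' : D = D'.
    by apply: contraNeq nchi => nDD'; rewrite S_orth.
  subst D'; congr Tagged; apply: contraNeq nchi => ii'.
  by rewrite cfdot_chi_irr ?sJ.
- split.
    apply: allpairs_uniq_dep => [|h _|]; rewrite ?enum_uniq //.
    move=> _ _ /allpairsPdep[h [D [Ch RD ->]]] /allpairsPdep[h' [D' [Ch' RD' ->]]] /= eK.
    rewrite !mem_enum in Ch Ch' RD RD'.
    have [g Kg] := Kclass_neq0 b_mono (sC h Ch) (sRhJ h D Ch RD).
    by have [|-> ->] := K_inter h D h' D' g Ch RD Ch' RD' Kg; rewrite -?eK.
  apply/and3P; split.
  + apply/eqP/setP=> g; apply/bigcupP/idP=> [[X]|Gg].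
      rewrite inE => /KP[h [D [Ch RD ->]]]; apply/subsetP.
      by apply: Kclass_sub; [apply: sC | apply: sRhJ Ch RD].
    have [h [D [Ch RD Kg]]] := Kclass_cover b_mono C_repr Rh_repr Gg.
    by exists (Kclass b h D); rewrite // inE KI.
  + apply/trivIsetP=> X Y; rewrite !inE => /KP[h [D [Ch RD ->]]] /KP[h' [D' [Ch' RD' ->]]].
    apply: contraR => /pred0Pn[g /andP[Kg Kg']].
    by have [-> ->] := K_inter _ _ _ _ _ Ch RD Ch' RD' Kg Kg'.
  rewrite inE; apply/negP=> /KP[h [D [Ch RD]]].
  have [g Kg] := Kclass_neq0 b_mono (sC h Ch) (sRhJ h D Ch RD).
  by move=> e0; rewrite -e0 inE in Kg.
- move=> _ _ /SP[D [i [RD ->]]] /KP[h [D' [Ch RD' ->]]].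
  exact: chi_const_Kclass (sJ D RD) (sC h Ch) (sRhJ h D' Ch RD').
have [h [D [Ch RD <-]]] := one_Kclass b_mono C_repr Rh_repr.
exact: KI.
Qed.
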